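(* Let $\Bbbk$ be a field and let $A$ be a (finite-dimensional) Frobenius $\Bbbk$-algebra with nonsingular associative $\Bbbk$-bilinear form $\beta$ and associated Higman trace $\tau=\tau_\beta\colon A\to A$. Assume that $\Bbbk$ is a splitting field for $A$. Let $c\colon K_0(A)\to G_0(A)$ be the Cartan map, $C$ the Cartan matrix of $A$, and $\widetilde{\tau}\colon T(A/\operatorname{rad}A)\to A$ the $\Bbbk$-linear map induced by $\tau$. Then: (a) $\operatorname{rank}(c\otimes 1_\Bbbk)=\operatorname{rank}\tau$, where $c\otimes 1_\Bbbk\colon K_0(A)\otimes_{\mathbb Z}\Bbbk\to G_0(A)\otimes_{\mathbb Z}\Bbbk$ and the rank of a $\Bbbk$-linear map is the $\Bbbk$-dimension of its image. (b) The following are equivalent: (i) $A$ is semisimple; (ii) $C=\operatorname{Id}$ and $\widetilde{\tau}^{-1}(A^\times\cup\{0\})\neq 0$; (iii) $\operatorname{char}\Bbbk$ does not divide $\det C$ and $\widetilde{\tau}^{-1}(A^\times\cup\{0\})\neq 0$.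
   Context: All algebras are associative with $1$ (and $A\ne 0$). $A^\times$ is the group of units of $A$, $\operatorname{rad}A$ the Jacobson radical. Frobenius algebras. $A^*=\operatorname{Hom}_\Bbbk(A,\Bbbk)$ is an $(A,A)$-bimodule via $(afb)(x)=f(bxa)$. A finite-dimensional $\Bbbk$-algebra $A$ is Frobenius if $A\cong A^*$ as left $A$-modules; equivalently, there is a $\Bbbk$-bilinear form $\beta\colon A\times A\to\Bbbk$ that is associative ($\beta(ab,c)=\beta(a,bc)$) and nonsingular ($a\mapsto\beta(\,\cdot\,,a)$ is an isomorphism $A\to A^*$). Dual bases for $\beta$ are finite families $\{x_i\},\{y_i\}$ in $A$ with $a=\sum_i\beta(a,y_i)x_i$ for all $a\in A$; the element $\sum_i x_i\otimes y_i\in A\otimes_\Bbbk A$ is determined by $\beta$. The Higman trace associated to $\beta$ is $\tau=\tau_\beta\colon A\to A$, $\tau(a)=\sum_i x_i a y_i$. The map $\widetilde\tau$. For a ring $R$, $[R,R]$ is the additive subgroup generated by all $xy-yx$, and $T(R)=R/[R,R]$. The Higman trace vanishes on $[A,A]$ and on $\operatorname{rad}A$, so it induces a $\Bbbk$-linear map $\widetilde\tau\colon T(A/\operatorname{rad}A)\to A$ with $\tau=\widetilde\tau\circ\mathrm{can}$, where $\mathrm{can}\colon A\to T(A/\operatorname{rad}A)$ is the canonical surjection. The condition $\widetilde\tau^{-1}(A^\times\cup\{0\})\ne 0$ means that there is a nonzero $x\in T(A/\operatorname{rad}A)$ such that $\widetilde\tau(x)$ is a unit of $A$ or $0$; this condition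 depends only on $A$, not on $\beta$. Grothendieck groups. $K_0(A)$ is the Grothendieck group of finitely generated projective left $A$-modules, $G_0(A)$ that of all finitely generated left $A$-modules (relations from short exact sequences). The Cartan map $c\colon K_0(A)\to G_0(A)$ sends $[P]$ to $[P]$. Both groups are free abelian of the same finite rank, the number of isomorphism classes of irreducible left $A$-modules; the Cartan matrix $C$ is the square integer matrix of $c$ with respect to the $\mathbb Z$-basis of $G_0(A)$ given by the classes of the irreducible modules $V$ and the $\mathbb Z$-basis of $K_0(A)$ given by the classes of their projective covers $P(V)$, correspondingly indexed. $\Bbbk$ is a splitting field for $A$ if $\operatorname{End}_A(V)=\Bbbk$ for every irreducible left $A$-module $V$. When $\operatorname{char}\Bbbk=0$, ''$\operatorname{char}\Bbbk$ does not divide $\det C$'' means $\det C\neq 0$. *)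

(* Defs.v *)
From HB Require Import structures.
From mathcomp Require Import all_boot all_algebra all_field.
From mathcomp Require Import sesquilinear boolp.
From mathcomp Require Import freeg.

Set Implicit Arguments.
Unset Strict Implicit.
Unset Printing Implicit Defensive.

Import GRing.Theory.

Local Open Scope ring_scope.
Local Open Scope quotient_scope.

Section ModuleQuotient.
Variables (R : pzRingType) (V : lmodType R).

(* The field has type [V -> bool] rather than [{pred V}] to keep [submodule] in the
   universe of [choiceType]. *)
Record submodule := Submodule {
  submod_fun : V -> bool;
  submod_funP : submod_closed (submod_fun : {pred V}) }.

Coercion submod_pred (S : submodule) : {pred V} := submod_fun S.

Lemma submodP (S : submodule) : submod_closed S.
Proof. by case: S. Qed.

HB.instance Definition _ (S : submodule) :=
  GRing.isZmodClosed.Build V (submod_pred S) (GRing.submod_closedB (submodP S)).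

Lemma submodZ (S : submodule) (a : R) v : v \in S -> a *: v \in S.
Proof. by move=> Sv; rewrite -[_ *: _]addr0 (submodP S).2 // (submodP S).1. Qed.

Definition lquot (S : submodule) : Type := Quotient.quot (submod_pred S).

Section Instances.
Variable S : submodule.

HB.instance Definition _ := GRing.Zmodule.on (lquot S).

Definition lproj (v : V) : lquot S := \pi_(Quotient.quot (submod_pred S)) v.
Definition lrepr (x : lquot S) : V := repr (x : Quotient.quot (submod_pred S)).

Lemma lreprK x : lproj (lrepr x) = x.
Proof. exact: reprK. Qed.

Lemma lproj_eq u v : (lproj u = lproj v) <-> (u - v \in S).
Proof.
by rewrite (Quotient.idealrBE (submod_pred S)); split=> [/eqP//|/eqP].
Qed.

Lemma lprojB : zmod_morphism lproj.
Proof. by move=> u v; rewrite /lproj raddfB. Qed.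

Definition lquot_scale (a : R) (x : lquot S) : lquot S := lproj (a *: lrepr x).

Lemma lproj_scale a v : lquot_scale a (lproj v) = lproj (a *: v).
Proof.
by apply/lproj_eq; rewrite -scalerBr submodZ //; apply/lproj_eq/lreprK.
Qed.

Lemma lprojD u v : lproj (u + v) = lproj u + lproj v.
Proof. by rewrite /lproj raddfD. Qed.

Fact lquot_scaleA a b x :
  lquot_scale a (lquot_scale b x) = lquot_scale (a * b) x.
Proof. by rewrite -(lreprK x) !lproj_scale scalerA. Qed.

Fact lquot_scale1 : left_id 1 lquot_scale.
Proof. by move=> x; rewrite -(lreprK x) lproj_scale scale1r. Qed.

Fact lquot_scaleDr : right_distributive lquot_scale +%R.
Proof.
move=> a x y; rewrite -(lreprK x) -(lreprK y) -lprojD !lproj_scale.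
by rewrite scalerDr lprojD.
Qed.

Fact lquot_scaleDl x : {morph lquot_scale^~ x : a b / a + b}.
Proof. by move=> a b; rewrite -(lreprK x) !lproj_scale scalerDl lprojD. Qed.

HB.instance Definition _ := GRing.Zmodule_isLmodule.Build R (lquot S)
  lquot_scaleA lquot_scale1 lquot_scaleDr lquot_scaleDl.

HB.instance Definition _ := GRing.isZmodMorphism.Build V (lquot S) lproj lprojB.

Fact lproj_is_scalable : scalable lproj.
Proof. by move=> a v; rewrite -lproj_scale. Qed.

HB.instance Definition _ :=
  GRing.isScalable.Build R V (lquot S) *:%R lproj lproj_is_scalable.

End Instances.

Definition span_pred (G : V -> Prop) : {pred V} :=
  fun v => `[< forall S : submodule, (forall g, G g -> g \in S) -> v \in S >].

Fact span_closed G : submod_closed (span_pred G).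
Proof.
split=> [|a u v /asboolP Gu /asboolP Gv]; apply/asboolP=> S GS.
  exact: (submodP S).1.
by rewrite (submodP S).2 ?Gu ?Gv.
Qed.

Definition span_submod G := @Submodule (span_pred G) (span_closed G).

Lemma mem_span (G : V -> Prop) v : G v -> v \in span_submod G.
Proof. by move=> Gv; apply/asboolP => S; apply. Qed.

End ModuleQuotient.

Arguments lproj {R V}.
Arguments lrepr {R V S}.

Section Generated.
Variables (V : zmodType) (G : V -> Prop).

Definition gen_pred : {pred V} :=
  fun v => `[< forall S : zmodClosed V, (forall g, G g -> g \in S) -> v \in S >].

Fact gen_closed : zmod_closed gen_pred.
Proof.
split=> [|u v /asboolP Gu /asboolP Gv]; apply/asboolP=> S GS.
  exact: rpred0.
by rewrite rpredB ?Gu ?Gv.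
Qed.

HB.instance Definition _ := GRing.isZmodClosed.Build V gen_pred gen_closed.

Lemma mem_gen v : G v -> v \in gen_pred.
Proof. by move=> Gv; apply/asboolP => S; apply. Qed.

Lemma gen_min (S : zmodClosed V) v :
  (forall g, G g -> g \in S) -> v \in gen_pred -> v \in S.
Proof. by move=> GS /asboolP; apply. Qed.

Definition gquot : Type := Quotient.quot gen_pred.
HB.instance Definition _ := GRing.Zmodule.on gquot.

Definition gproj (v : V) : gquot := \pi_(Quotient.quot gen_pred) v.
Definition grepr (x : gquot) : V := repr (x : Quotient.quot gen_pred).

Lemma greprK x : gproj (grepr x) = x.
Proof. exact: reprK. Qed.

Lemma gproj_eq u v : (gproj u = gproj v) <-> (u - v \in gen_pred).
Proof. by rewrite (Quotient.idealrBE gen_pred); split=> [/eqP//|/eqP]. Qed.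

Lemma gprojB : zmod_morphism gproj.
Proof. by move=> u v; rewrite /gproj raddfB. Qed.

HB.instance Definition _ := GRing.isZmodMorphism.Build V gquot gproj gprojB.

End Generated.

Arguments gproj {V}.
Arguments grepr {V G}.

Section Modules.
Variable R : nzRingType.

Definition surjective (U V : Type) (f : U -> V) := forall v, exists u, f u = v.

Definition mod_iso (U V : lmodType R) := exists f : {linear U -> V}, bijective f.

Definition irreducible_mod (V : lmodType R) :=
  (exists v : V, v != 0) /\
  forall S : submodule V, (forall v, v \in S -> v = 0) \/ (forall v, v \in S).

Definition projective_mod (P : lmodType R) :=
  forall (M N : lmodType R) (g : {linear M -> N}) (f : {linear P -> N}),
    surjective g -> exists h : {linear P -> M}, forall p, g (h p) = f p.

(* [P] is projective and maps onto [V] with superfluous kernel *)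
Definition projective_cover (P V : lmodType R) :=
  projective_mod P /\
  exists f : {linear P -> V}, surjective f /\
    forall S : submodule P,
      (forall p, exists2 s, s \in S & f (p - s) = 0) -> forall p, p \in S.

Definition semisimple_mod (V : lmodType R) :=
  forall S : submodule V, exists T : submodule V,
    (forall v, v \in S -> v \in T -> v = 0) /\
    (forall v, exists2 s, s \in S & v - s \in T).

Definition semisimple_ring := semisimple_mod R^o.

Definition short_exact (U V W : lmodType R) :=
  exists (i : {linear U -> V}) (p : {linear V -> W}),
    [/\ injective i, surjective p & forall v, p v = 0 <-> exists u, i u = v].

Definition finitely_generated (V : lmodType R) :=
  exists n (g : 'I_n -> V), forall v, exists a : 'I_n -> R,
    v = \sum_(i < n) a i *: g i.

(* The class of all finitely generated modules is not a small type; every such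
   module is isomorphic to a quotient of some R^n (lemma [fgmodP]), and these
   quotients form the small type [fgmod]. *)
Record fgmod := FgMod { fgrank : nat; fgker : submodule 'rV[R]_fgrank }.

HB.instance Definition _ := gen_eqMixin fgmod.
HB.instance Definition _ := gen_choiceMixin fgmod.

Definition fgcar (M : fgmod) : lmodType R := lquot (fgker M).

Lemma fgcar_fg (M : fgmod) : finitely_generated (fgcar M).
Proof.
exists (fgrank M), (fun i => lproj (fgker M) (delta_mx 0 i)) => x.
exists (fun i => (lrepr x) 0 i).
rewrite -{1}[x]lreprK {1}(row_sum_delta (lrepr x)) linear_sum.
by apply: eq_bigr => i _; rewrite linearZ.
Qed.

Lemma fgmodP (V : lmodType R) :
  finitely_generated V -> exists M : fgmod, mod_iso (fgcar M) V.
Proof.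
case=> n [g gP].
pose f (r : 'rV[R]_n) : V := \sum_(i < n) r 0 i *: g i.
have f_lin : linear f.
  move=> a u v; rewrite /f scaler_sumr -big_split; apply: eq_bigr => i _.
  by rewrite !mxE scalerDl scalerA.
pose fL := GRing.isLinear.Build _ _ _ _ f f_lin.
pose F : {linear 'rV[R]_n -> V} := HB.pack f fL.
have kerP : submod_closed (fun r => F r == 0).
  split=> [|a u v /eqP u0 /eqP v0]; apply/eqP; first exact: (linear0 F).
  by rewrite (linearP F) u0 v0 scaler0 addr0.
pose K := Submodule kerP; exists (FgMod K).
pose h (x : fgcar (FgMod K)) : V := F (lrepr x).
have hE r : h (lproj K r) = F r.
  apply/eqP; rewrite -subr_eq0 -linearB.
  by have /lproj_eq := lreprK (lproj K r).
have h_lin : linear h.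
  by move=> a x y; rewrite -[x]lreprK -[y]lreprK -linearP !hE linearP.
pose hL := GRing.isLinear.Build _ _ _ _ h h_lin.
pose H : {linear fgcar (FgMod K) -> V} := HB.pack h hL.
have sF v : exists r, F r == v.
  have [a ->] := gP v; exists (\row_i a i).
  by apply/eqP/eq_bigr => i _; rewrite mxE.
exists H; exists (fun v => lproj K (xchoose (sF v))) => [x|v].
  rewrite -[RHS]lreprK; apply/lproj_eq/eqP; rewrite (linearB F).
  by rewrite (eqP (xchooseP (sF _))) subrr.
by rewrite [LHS]hE; apply/eqP/(xchooseP (sF v)).
Qed.

Definition fgproj := {P : fgmod | `[< projective_mod (fgcar P) >]}.

HB.instance Definition _ := Choice.on fgproj.

Section Grothendieck.
Variables (X : choiceType) (car : X -> lmodType R).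

Definition ses_rel (z : {freeg X / int}) := exists U V W : X,
  short_exact (car U) (car V) (car W) /\ z = << V >> - << U >> - << W >>.

Definition groth : zmodType := gquot ses_rel.
Definition groth_class (M : X) : groth := gproj ses_rel << M >>.

End Grothendieck.

Definition G0 : zmodType := groth fgcar.
Definition K0 : zmodType := groth (fun P : fgproj => fgcar (val P)).

Definition G0_class : fgmod -> G0 := groth_class fgcar.
Definition K0_class : fgproj -> K0 :=
  groth_class (fun P : fgproj => fgcar (val P)).

Definition cartan_free (z : {freeg fgproj / int}) : {freeg fgmod / int} :=
  fglift (fun P : fgproj => << val P >>) z.

Fact cartan_freeB : zmod_morphism cartan_free.
Proof. exact: lift_is_additive. Qed.

HB.instance Definition _ :=
  GRing.isZmodMorphism.Build _ _ cartan_free cartan_freeB.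

Lemma cartan_freeU P : cartan_free << P >> = << val P >>.
Proof. by rewrite /cartan_free liftU scale1r. Qed.

(* the Cartan map [P] |-> [P] *)
Definition cartan (x : K0) : G0 := gproj (ses_rel fgcar) (cartan_free (grepr x)).

Lemma cartan_proj z : cartan (gproj _ z) = gproj _ (cartan_free z).
Proof.
apply/gproj_eq; rewrite -raddfB.
have /gproj_eq := greprK (gproj (ses_rel (fun P : fgproj => fgcar (val P))) z).
move: (_ - z) => t; pose Q := gen_pred (ses_rel fgcar).
pose S : {pred {freeg fgproj / int}} := fun z => cartan_free z \in Q.
have S_closed : zmod_closed S.
  split=> [|u v Su Sv]; rewrite /in_mem /= /S ?raddf0 ?rpred0 //.
  by rewrite raddfB rpredB.
pose SZ := GRing.isZmodClosed.Build _ S S_closed.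
pose S' : zmodClosed {freeg fgproj / int} := HB.pack S SZ.
apply: (@gen_min _ _ S') => _ [U [V [W [UVW ->]]]].
rewrite /in_mem /= /S !raddfB /= !cartan_freeU.
by apply/mem_gen; exists (val U), (val V), (val W).
Qed.

Lemma cartanB : zmod_morphism cartan.
Proof.
move=> x y; rewrite -[x]greprK -[y]greprK -raddfB !cartan_proj.
by rewrite -raddfB -raddfB.
Qed.

HB.instance Definition _ := GRing.isZmodMorphism.Build K0 G0 cartan cartanB.

Lemma cartanE P : cartan (K0_class P) = G0_class (val P).
Proof. by rewrite [LHS]cartan_proj cartan_freeU. Qed.

Section CartanMatrix.
Variables (n : nat) (V : 'I_n -> fgmod) (P : 'I_n -> fgproj).

Definition irreducible_reps :=
  [/\ forall i, irreducible_mod (fgcar (V i)),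
      forall i j, mod_iso (fgcar (V i)) (fgcar (V j)) -> i = j &
      forall S : lmodType R, irreducible_mod S ->
        exists i, mod_iso S (fgcar (V i))].

Definition projective_covers :=
  forall i, projective_cover (fgcar (val (P i))) (fgcar (V i)).

Definition is_cartan_matrix (C : 'M[int]_n) :=
  forall j, cartan (K0_class (P j)) = \sum_(i < n) G0_class (V i) *~ C i j.

End CartanMatrix.

End Modules.

Arguments cartan : clear implicits.
Arguments semisimple_ring : clear implicits.

Lemma fgliftZ (R : nzRingType) (K : choiceType) (M : lmodType R) (f : K -> M) c z :
  fglift f (c *: z) = c *: fglift f z.
Proof.
pose fB := GRing.isZmodMorphism.Build _ _ (fglift f) (@lift_is_additive R K M f).
pose F : {additive {freeg K / R} -> M} := HB.pack (fglift f) fB.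
rewrite -[c *: z]/(fgscale c z) -{2}[z]freeg_sumE.
have Fsum := raddf_sum F; rewrite /= in Fsum.
rewrite /fgscale !Fsum scaler_sumr.
by apply: eq_bigr => x _; rewrite !liftU scalerA.
Qed.

Section Tensor.
Variable k : comNzRingType.

(* [M ⊗_Z k]: the free k-module on the pairs (m, a), which stand for m ⊗ a,
   modulo biadditivity and c(m ⊗ a) = m ⊗ ca *)
Definition tens_rel (M : zmodType) (z : {freeg (M * k)%type / k}) :=
  [\/ exists m m' a, z = << (m + m', a) >> - << (m, a) >> - << (m', a) >>,
      exists m a b, z = << (m, a + b) >> - << (m, a) >> - << (m, b) >> |
      exists m a c, z = << (m, c * a) >> - c *: << (m, a) >> ].

Definition tens (M : zmodType) : lmodType k := lquot (span_submod (@tens_rel M)).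

Definition pure_tens (M : zmodType) (m : M) (a : k) : tens M :=
  lproj _ << (m, a) >>.

Section Map.
Variables (M N : zmodType) (f : {additive M -> N}).

Definition tens_free (z : {freeg (M * k)%type / k}) : {freeg (N * k)%type / k} :=
  fglift (fun p => << (f p.1, p.2) >>) z.

Fact tens_freeB : zmod_morphism tens_free.
Proof. exact: lift_is_additive. Qed.

HB.instance Definition _ :=
  GRing.isZmodMorphism.Build _ _ tens_free tens_freeB.

Lemma tens_freeU p : tens_free << p >> = << (f p.1, p.2) >>.
Proof. by rewrite /tens_free liftU scale1r. Qed.

Fact tens_freeZ : scalable tens_free.
Proof.
by move=> c z; exact: fgliftZ.
Qed.

HB.instance Definition _ := GRing.isScalable.Build _ _ _ _ tens_free tens_freeZ.

(* f ⊗ 1 *)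
Definition tens_map (x : tens M) : tens N := lproj _ (tens_free (lrepr x)).

Lemma tens_map_proj z : tens_map (lproj _ z) = lproj _ (tens_free z).
Proof.
apply/lproj_eq; rewrite -raddfB.
have /lproj_eq := lreprK (lproj (span_submod (@tens_rel M)) z).
move: (_ - z) => t /asboolP tP.
pose S : {pred {freeg (M * k)%type / k}} :=
  fun z => tens_free z \in span_submod (@tens_rel N).
have S_closed : submod_closed S.
  split=> [|c u v Su Sv]; rewrite /in_mem /= /S ?linear0 ?linearP.
    exact: (submodP _).1.
  exact: (submodP _).2.
apply: (tP (@Submodule _ _ S S_closed)) => {tP}t [].
- case=> m [m' [a ->]]; rewrite /in_mem /= /S !raddfB /= !tens_freeU /= raddfD.
  by apply/mem_span/Or31; exists (f m), (f m'), a.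
- case=> m [a [b ->]]; rewrite /in_mem /= /S !raddfB /= !tens_freeU /=.
  by apply/mem_span/Or32; exists (f m), a, b.
case=> m [a [c ->]]; rewrite /in_mem /= /S raddfB /= tens_freeZ !tens_freeU /=.
by apply/mem_span/Or33; exists (f m), a, c.
Qed.

Fact tens_map_linear : linear tens_map.
Proof.
move=> c x y; rewrite -[x]lreprK -[y]lreprK -linearP !tens_map_proj.
by rewrite -linearP -linearP.
Qed.

HB.instance Definition _ :=
  GRing.isLinear.Build k (tens M) (tens N) _ tens_map tens_map_linear.

Lemma tens_mapE m a : tens_map (pure_tens m a) = pure_tens (f m) a.
Proof. by rewrite [LHS]tens_map_proj tens_freeU. Qed.

End Map.

Definition has_rank (U W : lmodType k) (f : {linear U -> W}) (r : nat) :=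
  exists b : 'I_r -> W,
    [/\ forall i, exists u, f u = b i,
        forall a : 'I_r -> k, \sum_(i < r) a i *: b i = 0 -> forall i, a i = 0 &
        forall u, exists a : 'I_r -> k, f u = \sum_(i < r) a i *: b i].

End Tensor.

Arguments tens_map k {M N} f x.

Section Trace.
Variables (k : fieldType) (R : algType k).

Definition commutator_rel (z : R) := exists x y, z = x * y - y * x.

Fact commutator_closed : submod_closed (gen_pred commutator_rel).
Proof.
split=> [|c u v Gu Gv]; first exact: rpred0.
apply: rpredD => //.
pose S : {pred R} := fun u => c *: u \in gen_pred commutator_rel.
have S_closed : zmod_closed S.
  split=> [|x y Sx Sy]; rewrite /in_mem /= /S ?scaler0 ?rpred0 //.
  by rewrite scalerBr rpredB.
pose SZ := GRing.isZmodClosed.Build _ S S_closed.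
pose S' : zmodClosed R := HB.pack S SZ.
apply: (@gen_min _ _ S' _ _ Gu) => _ [x [y ->]].
apply: mem_gen; exists (c *: x), y.
by rewrite scalerBr -scalerAl -scalerAr.
Qed.

(* [R, R] is the additive subgroup generated by commutators; it is also a
   k-subspace, so that T(R) = R / [R, R] is a k-space *)
Definition commutators := Submodule commutator_closed.

Definition Tspace : lmodType k := lquot commutators.

End Trace.

Section Radical.
Variables (k : fieldType) (A : falgType k).

Definition rad_pred : {pred A} := fun a =>
  `[< forall V : lmodType A, irreducible_mod V -> forall v : V, a *: v = 0 >].

Fact rad_mull a b : b \in rad_pred -> a * b \in rad_pred.
Proof.
move=> /asboolP bP; apply/asboolP => V irrV v.
by rewrite -scalerA (bP V) ?scaler0.
Qed.

Fact rad_mulr a b : a \in rad_pred -> a * b \in rad_pred.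
Proof.
by move=> /asboolP aP; apply/asboolP => V irrV v; rewrite -scalerA (aP V).
Qed.

Fact rad_closed : submod_closed rad_pred.
Proof.
split=> [|c u v /(rad_mull (c *: 1)) /asboolP uP /asboolP vP]; apply/asboolP.
  by move=> V _ v; rewrite scale0r.
move=> V irrV w; rewrite -[u]mul1r scalerAl scalerDl.
by rewrite (uP V irrV) (vP V irrV) addr0.
Qed.

(* the Jacobson radical: the common annihilator of the irreducible modules *)
Definition rad := Submodule rad_closed.

Lemma irreducible_exists : exists V : lmodType A, irreducible_mod V.
Proof.
pose lid (U : {vspace A}) :=
  (forall a u, u \in U -> a * u \in U) /\ 1 \notin U.
pose D d := `[< exists U, lid U /\ \dim U = d >].
have D0 : exists d, D d.
  exists 0%N; apply/asboolP; exists 0%VS; rewrite dimv0; split=> //; split.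
    by move=> a u; rewrite !memv0 => /eqP->; rewrite mulr0.
  by rewrite memv0 oner_eq0.
have Dmax d : D d -> (d <= \dim {:A})%N.
  by case/asboolP=> U [_ <-]; exact/dimvS/subvf.
have [d /asboolP[U [[UM U1] dimU]] dmax] := ex_maxnP D0 Dmax.
have U_closed : submod_closed (fun u : A^o => u \in U).
  split=> [|a u v uU vU]; first exact: (mem0v U).
  by apply: (memvD (UM a u uU) vU).
pose K := Submodule U_closed.
have KZ (x y : A) : lproj K (x * y) = x *: lproj K y.
  exact: (@lproj_is_scalable _ _ K x y).
exists (lquot K); split.
  exists (lproj K 1); apply/eqP; rewrite -(raddf0 (lproj K)) => /lproj_eq.
  by rewrite subr0; apply/negP.
move=> S; have [[s sS s0]|noS] := pselect (exists2 s, s \in S & s <> 0); last first.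
  by left=> v vS; apply: contrapT => v0; apply: noS; exists v.
right; suff S1 : lproj K 1 \in S.
  by move=> v; rewrite -[v]lreprK -[lrepr v]mulr1 KZ submodZ.
pose a : A := lrepr s.
have aU : a \notin U.
  apply/negP=> aU; apply: s0; rewrite -[s]lreprK -[RHS](linear0 (lproj K)).
  by apply/lproj_eq; rewrite subr0.
pose W := (U + limg (amulr a))%VS.
have aW : a \in W.
  apply: (subvP (addvSr _ _)); have {1}-> : a = amulr a 1 by rewrite lfunE /= mul1r.
  exact: memv_img (memvf _).
have WM b w : w \in W -> b * w \in W.
  case/memv_addP=> u uU [_ /memv_imgP[x _ ->] ->]; rewrite mulrDr.
  apply: memv_add; first exact: UM.
  have -> : b * amulr a x = amulr a (b * x) by rewrite !lfunE /= mulrA.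
  exact: memv_img (memvf _).
have W1 : 1 \in W.
  apply: contraT => W1; have /dmax : D (\dim W) by apply/asboolP; exists W.
  rewrite -dimU leqNgt => /negP[]; rewrite (ltn_leqif (dimv_leqif_sup _)) ?addvSl //.
  by apply: contra aU => /subvP; apply.
case/memv_addP: W1 => u uU [_ /memv_imgP[x _ ->]].
rewrite lfunE /= => e.
have -> : lproj K 1 = x *: s.
  rewrite -[s]lreprK -KZ; apply/lproj_eq.
  have : (1 : A) - x * a \in U by rewrite e addrK.
  by [].
exact: submodZ.
Qed.

Lemma rad1 : 1 \notin rad.
Proof.
apply/negP => /asboolP r1; have [V irrV] := irreducible_exists.
by have [[v]] := irrV; rewrite -[v]scale1r r1 ?eqxx.
Qed.

Definition Arad : Type := lquot rad.
HB.instance Definition _ := GRing.Lmodule.on Arad.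

Definition Arad_one : Arad := lproj rad 1.
Definition Arad_mul (x y : Arad) : Arad := lproj rad (lrepr x * lrepr y).

Lemma Arad_mulE a b : Arad_mul (lproj rad a) (lproj rad b) = lproj rad (a * b).
Proof.
apply/lproj_eq; set a' := lrepr _; set b' := lrepr _.
have -> : a' * b' - a * b = a' * (b' - b) + (a' - a) * b.
  by rewrite mulrBr mulrBl addrA subrK.
have a'P : a' - a \in rad by apply/lproj_eq/lreprK.
have b'P : b' - b \in rad by apply/lproj_eq/lreprK.
by apply: rpredD; [exact: rad_mull | exact: rad_mulr].
Qed.

Fact Arad_mulA : associative Arad_mul.
Proof.
by move=> x y z; rewrite -[x]lreprK -[y]lreprK -[z]lreprK !Arad_mulE mulrA.
Qed.

Fact Arad_mul1 : left_id Arad_one Arad_mul.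
Proof. by move=> x; rewrite -[x]lreprK Arad_mulE mul1r. Qed.

Fact Arad_1mul : right_id Arad_one Arad_mul.
Proof. by move=> x; rewrite -[x]lreprK Arad_mulE mulr1. Qed.

Fact Arad_mulDl : left_distributive Arad_mul +%R.
Proof.
move=> x y z; rewrite -[x]lreprK -[y]lreprK -[z]lreprK.
by rewrite -raddfD !Arad_mulE mulrDl raddfD.
Qed.

Fact Arad_mulDr : right_distributive Arad_mul +%R.
Proof.
move=> x y z; rewrite -[x]lreprK -[y]lreprK -[z]lreprK.
by rewrite -raddfD !Arad_mulE mulrDr raddfD.
Qed.

Fact Arad_one_neq0 : Arad_one != 0.
Proof.
apply/eqP; rewrite -(raddf0 (lproj rad)) => /lproj_eq; rewrite subr0.
by apply/negP/rad1.
Qed.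

HB.instance Definition _ := GRing.Zmodule_isNzRing.Build Arad
  Arad_mulA Arad_mul1 Arad_1mul Arad_mulDl Arad_mulDr Arad_one_neq0.

Fact Arad_scaleAl (c : k) (x y : Arad) : c *: (x * y) = (c *: x) * y.
Proof.
rewrite -[LHS]/(c *: Arad_mul x y) -[RHS]/(Arad_mul (c *: x) y).
rewrite -[x]lreprK -[y]lreprK Arad_mulE -(lproj_is_scalable rad) /=.
by rewrite -(lproj_is_scalable rad) Arad_mulE /= scalerAl.
Qed.

HB.instance Definition _ := GRing.Lmodule_isLalgebra.Build k Arad Arad_scaleAl.

Fact Arad_scaleAr (c : k) (x y : Arad) : c *: (x * y) = x * (c *: y).
Proof.
rewrite -[LHS]/(c *: Arad_mul x y) -[RHS]/(Arad_mul x (c *: y)).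
rewrite -[x]lreprK -[y]lreprK Arad_mulE -(lproj_is_scalable rad) /=.
by rewrite -(lproj_is_scalable rad) Arad_mulE /= scalerAr.
Qed.

HB.instance Definition _ := GRing.Lalgebra_isAlgebra.Build k Arad Arad_scaleAr.

(* the canonical surjection A -> T(A / rad A) *)
Definition can_T (a : A) : Tspace Arad :=
  lproj (commutators Arad) (lproj rad a : Arad).

End Radical.

Arguments can_T {k} A a.

Section Frobenius.
Variables (k : fieldType) (A : falgType k).

Definition splitting_field := forall V : lmodType A, irreducible_mod V ->
  forall f : {linear V -> V}, exists c : k, forall v, f v = (c%:A : A) *: v.

Definition associative_form (beta : {biscalar A}) :=
  forall a b c, beta (a * b) c = beta a (b * c).

Definition nonsingular_form (beta : {biscalar A}) :=
  bijective (fun a : A => linfun (fun x : A => beta x a : k^o) : 'Hom(A, k^o)).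

Section HigmanTrace.
Variables (m : nat) (x y : 'I_m -> A).

Definition dual_bases (beta : {biscalar A}) :=
  forall a, a = \sum_(i < m) beta a (y i) *: x i.

Definition higman_trace (a : A) : A := \sum_(i < m) x i * a * y i.

Fact higman_trace_linear : linear higman_trace.
Proof.
move=> c a b; rewrite /higman_trace scaler_sumr -big_split.
by apply: eq_bigr => i _; rewrite mulrDr mulrDl -scalerAr -scalerAl.
Qed.

HB.instance Definition _ :=
  GRing.isLinear.Build k A A _ higman_trace higman_trace_linear.

(* [t] is the map T(A / rad A) -> A induced by the Higman trace *)
Definition induced_trace (t : {linear Tspace (Arad A) -> A}) :=
  forall a, higman_trace a = t (can_T A a).

End HigmanTrace.

(* the preimage under [t] of the units and 0 is not reduced to 0 *)
Definition unit_or_zero_preimage (t : {linear Tspace (Arad A) -> A}) :=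
  exists2 z, z != 0 & t z \is a GRing.unit \/ t z = 0.

Definition char_divides (d : int) :=
  (exists2 p, p \in [pchar k] & (p%:Z %| d)%Z) \/
  ([pchar k] =i pred0 /\ d = 0).

End Frobenius.

Arguments splitting_field {k} A.
Arguments char_divides : clear implicits.

(* Main.v *)
From HB Require Import structures.
Require Import Defs.
From mathcomp Require Import all_boot all_algebra all_field.
From mathcomp Require Import sesquilinear boolp freeg.

Set Implicit Arguments.
Unset Strict Implicit.
Unset Printing Implicit Defensive.

Import GRing.Theory.
Local Open Scope ring_scope.

(** Everything is read off the bilinear function [lrtrace c a], the trace of the
k-linear map z |-> c z a on A. Summing over dual bases gives beta(c, tau(a)) =
lrtrace c a ([beta_higman]), so by nonsingularity tau is known once these traces
are. On the other hand the character of a projective module P with dual basis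
(f_i, g_i) is, by cyclicity of the trace, c |-> lrtrace c (sum_i f_i(g_i))
([act_trace_dual_basis]). Hence the characters of projective modules are
functionals of the form beta(-, tau(p)), and the Cartan map, which records how
these characters decompose into irreducible ones, has to have the rank of tau.

Two facts make this precise. First, a map on A that vanishes on commutators and
on rad A is determined by its values on n idempotents e_1, ..., e_n, where e_i
acts on the irreducible module V_i as a matrix unit of trace 1 and on the other
V_j as 0 ([dual_idempotents]); over a splitting field these come from the
density theorem and from lifting idempotents modulo the nilpotent ideal rad A.
The Higman trace is such a map, and lrtrace is one in each argument, because c
in rad A or a in rad A makes z |-> c z a nilpotent. Second, the classes [V_i]
span G_0(A), and [M] (x) 1 = sum_i chi_M(e_i) [V_i] (x) 1 in G_0(A) (x) k.

For the equality of ranks, the linear map theta(u) = sum_i beta(e_i, u) [V_i]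
(x) 1 is injective on the image of tau and sends it onto the image of c (x) 1:
theta(tau(p)) is the class of a projective module when p is its element sum_i
f_i(g_i), and tau(A) is spanned by the tau(e_i), which belong to the modules A
e_i ([cartan_rank]).

For the equivalences, if A is semisimple then P(V_j) is V_j, so C = 1, where the
integer entries are detected by the additive functions M |-> dim e_i M. The
element u with beta(c, u) = sum_j chi_j(c) is in the image of tau, and it is a
unit since w u = 0 forces all traces of c w on the V_j to vanish. Conversely,
every value of tau is annihilated by rad A, so a unit among them makes rad A
zero. If det C is not 0 in k, then C factors through the matrix of the lrtrace
(e_i) (e_l), which is therefore invertible, and tau can only vanish on a when
all chi_i(a) do, that is, when a is 0 in T(A / rad A). *)

(** * Linear maps and submodules *)

Section LinearMaps.
Variable R : pzRingType.

Lemma linear_map_of (V W : lmodType R) (f : V -> W) :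
  linear f -> {g : {linear V -> W} | forall v, g v = f v}.
Proof.
move=> f_lin; pose fL := GRing.isLinear.Build _ _ _ _ f f_lin.
by exists (HB.pack f fL : {linear V -> W}).
Qed.

Section Submodules.
Variables (V W : lmodType R) (f : {linear V -> W}).

Lemma lker_submod_closed : submod_closed (fun v => f v == 0).
Proof.
split=> [|a u v /eqP u0 /eqP v0]; apply/eqP; first exact: linear0.
by rewrite linearP u0 v0 scaler0 addr0.
Qed.
Definition lker_submod := Submodule lker_submod_closed.

Lemma mem_lker v : v \in lker_submod <-> f v = 0.
Proof. by split=> [/eqP|/eqP]. Qed.

Lemma limg_submod_closed : submod_closed (fun w => `[< exists v, f v = w >]).
Proof.
split=> [|a u v /asboolP[x <-] /asboolP[y <-]]; apply/asboolP.
  by exists 0; rewrite linear0.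
by exists (a *: x + y); rewrite linearP.
Qed.
Definition limg_submod := Submodule limg_submod_closed.

Lemma mem_limg w : w \in limg_submod <-> exists v, f v = w.
Proof. by split=> [/asboolP|/asboolP]. Qed.

Lemma linear_inj : (forall v, f v = 0 -> v = 0) -> injective f.
Proof. by move=> f0 u v fuv; apply/subr0_eq/f0; rewrite linearB fuv subrr. Qed.

(** Linear maps out of a quotient are obtained below as the factorization of a
linear map through a surjection whose kernel it kills. *)
Lemma factor_surj (U : lmodType R) (g : {linear V -> U}) :
  surjective f -> (forall v, f v = 0 -> g v = 0) ->
  {h : {linear W -> U} | forall v, h (f v) = g v}.
Proof.
move=> f_surj kfg; pose s w := sval (cid (f_surj w)).
have sK w : f (s w) = w by rewrite /s; case: cid.
have gs v : g (s (f v)) = g v.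
  by apply/subr0_eq; rewrite -linearB kfg // linearB sK subrr.
have [|h hE] := @linear_map_of _ _ (fun w => g (s w)).
  by move=> a u v /=; rewrite -{1}(sK u) -{1}(sK v) -linearP gs linearP.
by exists h => v; rewrite hE gs.
Qed.

End Submodules.

Lemma lproj_surj (V : lmodType R) (S : submodule V) : surjective (lproj S).
Proof. by move=> x; exists (lrepr x); exact: lreprK. Qed.

Lemma lproj_eq0 (V : lmodType R) (S : submodule V) v : lproj S v = 0 <-> v \in S.
Proof. by rewrite -(linear0 (lproj S)) lproj_eq subr0. Qed.

Lemma bij_inv_linear (V W : lmodType R) (f : {linear V -> W}) : bijective f ->
  exists2 g : {linear W -> V}, cancel f g & cancel g f.
Proof.
case=> g fK gK; have [|h hE] := @linear_map_of _ _ g.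
  by move=> a u v; rewrite -{1}(gK u) -{1}(gK v) -linearP fK.
by exists h => v; rewrite hE.
Qed.

Lemma inj_surj_bij (V W : lmodType R) (f : {linear V -> W}) :
  (forall v, f v = 0 -> v = 0) -> surjective f -> bijective f.
Proof.
move=> /linear_inj f_inj f_surj; exists (fun w => sval (cid (f_surj w))) => [v|w].
  by apply: f_inj; case: cid.
by case: cid.
Qed.

End LinearMaps.

Section OrbitMap.
Variables (R : nzRingType) (V : lmodType R) (v : V).

Definition orbit_map (a : R^o) : V := (a : R) *: v.

Fact orbit_map_linear : linear orbit_map.
Proof. by move=> a b c; rewrite /orbit_map scalerDl -scalerA. Qed.

HB.instance Definition _ :=
  GRing.isLinear.Build R R^o V _ orbit_map orbit_map_linear.

End OrbitMap.

(** * Universal properties of Grothendieck groups and tensor products *)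

Section FreeGroups.
Variable K : choiceType.

Lemma freeg_ind (R : nzRingType) (Q : {freeg K / R} -> Prop) :
  Q 0 -> (forall u v, Q u -> Q v -> Q (u + v)) ->
  (forall c x, Q << c *g x >>) -> forall z, Q z.
Proof.
by move=> Q0 QD QU z; rewrite -[z]freeg_sumE; apply: (big_ind Q).
Qed.

End FreeGroups.

Section GrothendieckUniversal.
Variables (R : nzRingType) (X : choiceType) (car : X -> lmodType R).

(** Closure under differences suffices, since the free group on the classes is
generated by them. *)
Lemma groth_ind (Q : groth car -> Prop) :
  (forall u v, Q u -> Q v -> Q (u - v)) ->
  (forall M, Q (groth_class car M)) -> Q 0 -> forall x, Q x.
Proof.
move=> QB QU Q0 x.
have QN u : Q u -> Q (- u) by move=> Qu; rewrite -sub0r; apply: (QB).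
have QD u v : Q u -> Q v -> Q (u + v).
  by move=> Qu Qv; rewrite -[v]opprK; apply: (QB) => //; apply: (QN).
rewrite -[x]greprK; elim/freeg_ind: (grepr x) => [|u v Qu Qv|c M].
- by rewrite raddf0.
- by rewrite raddfD; apply: (QD).
have QM (n : nat) : Q (gproj (ses_rel car) << n%:Z *g M >>).
  elim: n => [|n IHn]; first by rewrite freegU0 raddf0.
  by rewrite intS -freegUD raddfD; apply: (QD) => //; apply: (QU).
case: c => n; first exact: QM.
by rewrite NegzE -freegUN raddfN; apply/QN/QM.
Qed.

(** The universal property of a Grothendieck group; it turns traces and ranks,
which are additive on short exact sequences, into functions on [G0]. *)
Lemma groth_lift (Z : zmodType) (F : X -> Z) :
  (forall U V W, short_exact (car U) (car V) (car W) -> F V = F U + F W) ->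
  exists h : {additive groth car -> Z}, forall M, h (groth_class car M) = F M.
Proof.
move=> F_add; pose L (z : {freeg X / int}) : Z := fglift (F : X -> zmodule Z) z.
pose LB := GRing.isZmodMorphism.Build _ _ L (@lift_is_additive _ X (zmodule Z) F).
pose La : {additive {freeg X / int} -> Z} := HB.pack L LB.
have LaU M : La << M >> = F M by rewrite [LHS]liftU scale1r.
have kerL : zmod_closed (fun z => La z == 0).
  split=> [|u v /eqP u0 /eqP v0]; apply/eqP; first by rewrite raddf0.
  by rewrite raddfB u0 v0 subrr.
pose kerS := GRing.isZmodClosed.Build _ _ kerL.
pose S : zmodClosed {freeg X / int} := HB.pack (fun z => La z == 0) kerS.
have relS z : z \in gen_pred (ses_rel car) -> La z = 0.
  move/(@gen_min _ _ S) => H; apply/eqP/H => _ [U [V [W [UVW ->]]]].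
  by apply/eqP; rewrite !(raddfB La) !LaU (F_add _ _ _ UVW) addrAC addrK subrr.
have hE z : La (grepr (gproj (ses_rel car) z)) = La z.
  by apply/subr0_eq; rewrite -raddfB relS //; apply/gproj_eq/greprK.
pose h (x : groth car) := La (grepr x).
have hB : zmod_morphism h.
  by move=> x y; rewrite -[x]greprK -[y]greprK /h -raddfB !hE raddfB.
pose hM := GRing.isZmodMorphism.Build _ _ h hB.
exists (HB.pack h hM : {additive groth car -> Z}) => M.
by rewrite [LHS]hE LaU.
Qed.

End GrothendieckUniversal.

Section TensorUniversal.
Variables (k : comNzRingType) (M : zmodType).

Lemma freegUZ (X : choiceType) (c : k) (x : X) : << c *g x >> = c *: << x >>.
Proof.
by apply/eqP/freeg_eqP => y; rewrite coeffZ !coeffU mulrA mulr1.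
Qed.

Lemma pure_tensDl (m m' : M) (a : k) :
  pure_tens (m + m') a = pure_tens m a + pure_tens m' a.
Proof.
rewrite /pure_tens -raddfD; apply/lproj_eq/mem_span/Or31.
by exists m, m', a; rewrite opprD addrA.
Qed.

Lemma pure_tensZ (m : M) (c a : k) : pure_tens m (c * a) = c *: pure_tens m a.
Proof.
rewrite /pure_tens -lproj_is_scalable; apply/lproj_eq/mem_span/Or33.
by exists m, a, c.
Qed.

Lemma pure_tensB (m m' : M) (a : k) :
  pure_tens (m - m') a = pure_tens m a - pure_tens m' a.
Proof. by apply/(addIr (pure_tens m' a)); rewrite -pure_tensDl !subrK. Qed.

Lemma pure_tens0 (a : k) : pure_tens (0 : M) a = 0.
Proof. by rewrite -[0 in LHS](subrr 0) pure_tensB subrr. Qed.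

Lemma pure_tens_sum (I : Type) (r : seq I) (F : I -> M) (a : k) :
  pure_tens (\sum_(i <- r) F i) a = \sum_(i <- r) pure_tens (F i) a.
Proof.
by apply: (big_morph (fun m => pure_tens m a)) => [u v|]; rewrite ?pure_tensDl ?pure_tens0.
Qed.

Lemma pure_tensMz (m : M) (c : int) (a : k) :
  pure_tens (m *~ c) a = c%:~R *: pure_tens m a.
Proof.
have pureM (n : nat) : pure_tens (m *+ n) a = n%:R *: pure_tens m a.
  by elim: n => [|n IHn]; rewrite ?scale0r ?pure_tens0 // !mulrS pure_tensDl IHn scalerDl scale1r.
case: c => n; first exact: pureM.
by rewrite NegzE !mulrNz -[- _]sub0r pure_tensB pure_tens0 sub0r pureM scaleNr.
Qed.

(** Pure tensors with second factor 1 suffice, because m (x) a = a (m (x) 1). *)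
Lemma tens_ind (Q : tens k M -> Prop) :
  Q 0 -> (forall c u v, Q u -> Q v -> Q (c *: u + v)) ->
  (forall m, Q (pure_tens m 1)) -> forall u, Q u.
Proof.
move=> Q0 QL QP u; rewrite -[u]lreprK; elim/freeg_ind: (lrepr u) => [|x y|c [m a]].
- by rewrite raddf0.
- by rewrite lprojD => Qx Qy; rewrite -[X in Q (X + _)]scale1r; apply: QL.
rewrite freegUZ linearZ -[_ << _ >>]/(pure_tens m a) -[a]mulr1 pure_tensZ /=.
by rewrite scalerA -[_ *: _]addr0; apply: QL.
Qed.

Lemma tens_lift (W : lmodType k) (h : {additive M -> W}) :
  exists g : {linear tens k M -> W}, forall m a, g (pure_tens m a) = a *: h m.
Proof.
pose L (z : {freeg (M * k)%type / k}) : W := fglift (fun p => p.2 *: h p.1) z.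
have L_lin : linear L.
  pose LB := GRing.isZmodMorphism.Build _ _ L (@lift_is_additive _ _ _ _).
  pose La : {additive {freeg (M * k)%type / k} -> W} := HB.pack L LB.
  by move=> c u v; rewrite -[L _]/(La _) raddfD [La (c *: u)]fgliftZ.
have [g gE] := linear_map_of L_lin.
have gUZ c p : g << c *g p >> = c *: (p.2 *: h p.1) by rewrite gE /L liftU.
have gU p : g << p >> = p.2 *: h p.1 by rewrite gUZ scale1r.
have kerg z : z \in span_submod (@tens_rel k M) -> g z = 0.
  move/asboolP => /(_ (lker_submod g)) H; apply/mem_lker/H => t [] {H}.
  - case=> m [m' [a ->]]; apply/mem_lker; rewrite !raddfB /= !gU /= raddfD scalerDr.
    by rewrite addrAC addrK subrr.
  - case=> m [a [b ->]]; apply/mem_lker; rewrite !raddfB /= !gU /= scalerDl.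
    by rewrite addrAC addrK subrr.
  case=> m [a [c ->]]; apply/mem_lker.
  by rewrite -freegUZ raddfB /= !gUZ /= scale1r scalerA subrr.
have [|f fE] := factor_surj (g := g) (lproj_surj (S := span_submod (@tens_rel k M))).
  by move=> v /lproj_eq0/kerg.
by exists f => m a; rewrite fE gU.
Qed.

End TensorUniversal.

(** * Finite-dimensional modules over A and traces of k-linear maps *)

Section Coordinates.
Variables (k : fieldType) (A : falgType k).
Implicit Types L M N : lmodType A.

Lemma kscaleM M (a b : k) (v : M) :
  ((a * b)%:A : A) *: v = (a%:A : A) *: ((b%:A : A) *: v).
Proof. by rewrite scalerA mulr_algl scalerA. Qed.

(** Modules over A carry no declared k-structure; k acts on them through the
scalars [c%:A] of A. *)
Definition klinear M N (f : M -> N) :=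
  forall c x y, f ((c%:A : A) *: x + y) = (c%:A : A) *: f x + f y.

Lemma klinear_linear M N (f : {linear M -> N}) : klinear f.
Proof. by move=> c x y; rewrite linearP. Qed.

Lemma klinear_act M (a : A) : klinear (fun x : M => a *: x).
Proof. by move=> c x y; rewrite scalerDr !scalerA mulr_algl mulr_algr. Qed.

Lemma klinear_comp L M N (f : M -> N) (g : L -> M) :
  klinear f -> klinear g -> klinear (f \o g).
Proof. by move=> fL gL c x y /=; rewrite gL fL. Qed.

(** A k-linear identification with column vectors, that is, a k-basis. *)
Record coords M := Coords {
  cdim : nat;
  to_cv : M -> 'cV[k]_cdim;
  of_cv : 'cV[k]_cdim -> M;
  to_cvK : cancel to_cv of_cv;
  of_cvK : cancel of_cv to_cv;
  to_cvP : forall c x y, to_cv ((c%:A : A) *: x + y) = c *: to_cv x + to_cv y }.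

Arguments to_cv {M} _ _.
Arguments of_cv {M} _ _.
Arguments to_cvK {M} _ _.
Arguments of_cvK {M} _ _.
Arguments to_cvP {M} _ _ _ _.

Section Theory.
Variables (M : lmodType A) (b : coords M).

Lemma to_cv_inj : injective (to_cv b).
Proof. exact: can_inj (to_cvK b). Qed.

Lemma to_cvD x y : to_cv b (x + y) = to_cv b x + to_cv b y.
Proof. by have := to_cvP b 1 x y; rewrite !scale1r. Qed.

Lemma to_cv0 : to_cv b 0 = 0.
Proof. by apply: (addrI (to_cv b 0)); rewrite -to_cvD !addr0. Qed.

Lemma to_cvZ c x : to_cv b ((c%:A : A) *: x) = c *: to_cv b x.
Proof. by have := to_cvP b c x 0; rewrite to_cv0 !addr0. Qed.

Lemma to_cvB x y : to_cv b (x - y) = to_cv b x - to_cv b y.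
Proof. by apply/(addIr (to_cv b y)); rewrite -to_cvD !subrK. Qed.

Lemma to_cv_sum I (r : seq I) (F : I -> M) :
  to_cv b (\sum_(i <- r) F i) = \sum_(i <- r) to_cv b (F i).
Proof. exact: (big_morph _ to_cvD to_cv0). Qed.

Definition cbasis (i : 'I_(cdim b)) : M := of_cv b (delta_mx i 0).

Lemma to_cv_cbasis i : to_cv b (cbasis i) = delta_mx i 0.
Proof. exact: of_cvK. Qed.

Lemma cbasis_sum x : x = \sum_i ((to_cv b x i 0)%:A : A) *: cbasis i.
Proof.
apply: to_cv_inj; rewrite to_cv_sum; apply/colP => i.
rewrite summxE (bigD1 i) //= to_cvZ to_cv_cbasis !mxE eqxx mulr1 big1 ?addr0 // => j ji.
by rewrite to_cvZ to_cv_cbasis !mxE eq_sym (negPf ji) mulr0.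
Qed.

End Theory.

Arguments cbasis {M} b i.

(** A spanning family of least size is a basis: a nontrivial relation expresses
one of its members by the others, which then still span. *)
Lemma span_coords M d (s : 'I_d -> M) :
  (forall v, exists a : 'cV[k]_d, v = \sum_i ((a i 0)%:A : A) *: s i) ->
  exists b : coords M, True.
Proof.
elim: d s => [|d IHd] s s_span; last first.
  have [[a [a0 [j aj]]]|indep] := pselect (exists a : 'cV[k]_d.+1,
      \sum_i ((a i 0)%:A : A) *: s i = 0 /\ exists j, a j 0 != 0).
    apply: (IHd (fun i => s (fintype.lift j i))) => v; have [c ->] := s_span v.
    exists (\col_i (c (fintype.lift j i) 0 - c j 0 / a j 0 * a (fintype.lift j i) 0)).
    have -> : \sum_i ((c i 0)%:A : A) *: s i
        = \sum_i ((c i 0 - c j 0 / a j 0 * a i 0)%:A : A) *: s i.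
      under [RHS]eq_bigr => i _ do
        rewrite scalerBl scalerBl kscaleM.
      by rewrite sumrB -scaler_sumr a0 scaler0 subr0.
    rewrite (bigD1_ord j) //= divfK // subrr !scale0r add0r.
    by apply: eq_bigr => i _; rewrite mxE.
  pose f v := sval (cid (s_span v)).
  have fE v : v = \sum_i ((f v i 0)%:A : A) *: s i by rewrite /f; case: cid.
  have f_uniq v (a : 'cV[k]_d.+1) : v = \sum_i ((a i 0)%:A : A) *: s i -> f v = a.
    rewrite {1}(fE v) => e; apply/subr0_eq/colP => i; rewrite [RHS]mxE.
    apply/eqP/negPn/negP => ne0; apply: indep; exists (f v - a); split; last by exists i.
    under eq_bigr => j _ do rewrite !mxE !scalerBl.
    by rewrite sumrB e subrr.
  have fK : cancel f (fun a : 'cV[k]_d.+1 => \sum_i ((a i 0)%:A : A) *: s i).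
    by move=> v; rewrite -fE.
  have Kf : cancel (fun a : 'cV[k]_d.+1 => \sum_i ((a i 0)%:A : A) *: s i) f.
    by move=> a; apply: f_uniq.
  have fP c x y : f ((c%:A : A) *: x + y) = c *: f x + f y.
    apply: f_uniq; rewrite {1}(fE x) {1}(fE y) scaler_sumr -big_split.
    apply: eq_bigr => i _ /=; rewrite !mxE scalerA scalerDl scalerDl.
    by rewrite mulr_algl scalerA.
  by exists (Coords fK Kf fP).
have v0 (v : M) : v = 0 by have [a ->] := s_span v; rewrite big_ord0.
have toK : cancel (fun _ : M => 0 : 'cV[k]_0) (fun _ => 0) by move=> v; rewrite [RHS]v0.
have ofK : cancel (fun _ => 0) (fun _ : M => 0 : 'cV[k]_0) by move=> v; apply/colP => -[].
by exists (@Coords M 0 _ _ toK ofK (fun c x y => esym (etrans (addr0 _) (scaler0 _ _)))).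
Qed.

(** The products of a k-basis of A with A-generators of M span M over k. *)
Lemma fg_coords M : finitely_generated M -> exists b : coords M, True.
Proof.
case=> n [g gP]; pose e := vbasis {:A}.
pose T : finType := ('I_n * 'I_(\dim {:A}))%type.
pose s (t : T) : M := e`_t.2 *: g t.1.
apply: (@span_coords M #|T| (fun i => s (enum_val i))) => v.
have [a ->] := gP v.
exists (\col_i coord e (enum_val i).2 (a (enum_val i).1)).
under [RHS]eq_bigr => i _ do rewrite mxE.
rewrite -(@big_enum_val _ _ _ _ T (fun t => ((coord e t.2 (a t.1))%:A : A) *: s t)) /=.
rewrite -(pair_bigA _ (fun i j => ((coord e j (a i))%:A : A) *: s (i, j))) /=.
apply: eq_bigr => i _; rewrite {1}(coord_vbasis (memvf (a i))) scaler_suml.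
by apply: eq_bigr => j _; rewrite scalerA mulr_algl.
Qed.

Section Matrices.
Variables (M N : lmodType A) (bM : coords M) (bN : coords N).

Definition mx_of (f : M -> N) : 'M[k]_(cdim bN, cdim bM) :=
  \matrix_(i, j) to_cv bN (f (cbasis bM j)) i 0.

Lemma mx_ofE f x : klinear f -> to_cv bN (f x) = mx_of f *m to_cv bM x.
Proof.
move=> fL.
have fD u v : f (u + v) = f u + f v by have := fL 1 u v; rewrite !scale1r.
have f0 : f 0 = 0 by apply: (addrI (f 0)); rewrite -fD !addr0.
have fZ c u : f ((c%:A : A) *: u) = (c%:A : A) *: f u.
  by have := fL c u 0; rewrite f0 !addr0.
rewrite [in LHS](cbasis_sum bM x) [X in _ *m to_cv bM X](cbasis_sum bM x).
rewrite (big_morph f fD f0) !to_cv_sum mulmx_sumr; apply: eq_bigr => i _.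
rewrite fZ !to_cvZ to_cv_cbasis -scalemxAr; congr (_ *: _).
by apply/colP => j; rewrite -colE !mxE.
Qed.

Lemma mx_of_uniq f X : (forall x, to_cv bN (f x) = X *m to_cv bM x) -> mx_of f = X.
Proof.
move=> fX; apply/matrixP => i j; rewrite mxE fX to_cv_cbasis -colE.
by rewrite mxE.
Qed.

Lemma eq_mx_of f g : f =1 g -> mx_of f = mx_of g.
Proof. by move=> fg; apply/matrixP => i j; rewrite !mxE fg. Qed.

End Matrices.

Lemma mx_of_comp L M N (bL : coords L) (bM : coords M) (bN : coords N)
    (f : M -> N) (g : L -> M) : klinear f -> klinear g ->
  mx_of bL bN (f \o g) = mx_of bM bN f *m mx_of bL bM g.
Proof.
move=> fL gL; apply: mx_of_uniq => x /=.
by rewrite (mx_ofE bM) // (mx_ofE bL) // mulmxA.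
Qed.

Lemma mx_of_sum M N (bM : coords M) (bN : coords N) I (r : seq I) (f : I -> M -> N) :
  mx_of bM bN (fun x => \sum_(i <- r) f i x) = \sum_(i <- r) mx_of bM bN (f i).
Proof.
apply/matrixP => i j; rewrite mxE to_cv_sum !summxE.
by apply: eq_bigr => l _; rewrite mxE.
Qed.

Definition ktrace M (b : coords M) (f : M -> M) : k := \tr (mx_of b b f).

(** Cyclicity across two different modules; this is what transports a trace from
a projective module to A. *)
Lemma ktraceC M N (bM : coords M) (bN : coords N) (f : M -> N) (g : N -> M) :
  klinear f -> klinear g -> ktrace bM (g \o f) = ktrace bN (f \o g).
Proof.
move=> fL gL; rewrite /ktrace (mx_of_comp bM bN bM) // (mx_of_comp bN bM bN) //.
exact: mxtrace_mulC.
Qed.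

Lemma ktrace_sum M (b : coords M) I (r : seq I) (f : I -> M -> M) :
  ktrace b (fun x => \sum_(i <- r) f i x) = \sum_(i <- r) ktrace b (f i).
Proof. by rewrite /ktrace mx_of_sum raddf_sum. Qed.

Lemma eq_ktrace M (b : coords M) f g : f =1 g -> ktrace b f = ktrace b g.
Proof. by rewrite /ktrace => /(eq_mx_of b b) ->. Qed.

Lemma ktrace_rank1 M (b : coords M) (xi : M -> k) (v : M) :
  (forall c x y, xi ((c%:A : A) *: x + y) = c * xi x + xi y) ->
  ktrace b (fun x => ((xi x)%:A : A) *: v) = xi v.
Proof.
move=> xiL; have xi0 : xi 0 = 0.
  apply: (addrI (xi 0)); have := xiL 1 0 0.
  by rewrite !scale1r mul1r !addr0 => <-.
have xiD x y : xi (x + y) = xi x + xi y by have := xiL 1 x y; rewrite scale1r scale1r mul1r.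
rewrite [in RHS](cbasis_sum b v) (big_morph xi xiD xi0) /ktrace.
apply: eq_bigr => i _; rewrite mxE to_cvZ mxE mulrC.
by rewrite -[X in _ = xi X]addr0 xiL xi0 addr0.
Qed.

End Coordinates.

#[global] Hint Resolve klinear_act klinear_linear : core.

Arguments cbasis {k A M} b i.
Arguments to_cv {k A M} _ _.
Arguments of_cv {k A M} _ _.
Arguments to_cvK {k A M} _ _.
Arguments of_cvK {k A M} _ _.

(** Writing N = C R with C and R of full rank, tr N = tr (R C), and R C is
nilpotent of smaller index since C (R C)^j R = N^(j+1). *)
Lemma mxtrace_nilpotent (k : fieldType) m n (N : 'M[k]_n) : N ^+ m = 0 -> \tr N = 0.
Proof.
elim: m n N => [|m IHm] n N Nm0.
  by rewrite -[N]mulr1 -[X in N * X](expr0 N) Nm0 mulr0 mxtrace0.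
rewrite -[N]mulmx_base mxtrace_mulC; apply: IHm.
set C := col_base N; set R := row_base N.
have CRm j : N ^+ j.+1 = C *m (R *m C) ^+ j *m R.
  elim: j => [|j IHj]; first by rewrite expr0 expr1 mulmx1 mulmx_base.
  by rewrite exprS IHj -{1}[N]mulmx_base -/C -/R exprS -!mulmxE !mulmxA.
have /eqP := CRm m; rewrite Nm0 eq_sym mulmx_free_eq0 ?row_base_free //.
move=> /eqP C0; apply: (row_full_inj (col_base_full N)).
by rewrite C0 mulmx0.
Qed.

(** * Irreducible modules and composition series *)

Section Irreducible.
Variable R : nzRingType.
Implicit Types U V W : lmodType R.

Lemma irreducible_cyclic V (v w : V) :
  irreducible_mod V -> v != 0 -> exists a, a *: v = w.
Proof.
move=> [_ /(_ (limg_submod (orbit_map v)))[v0|vT]] vN0.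
  have /v0 v00 : v \in limg_submod (orbit_map v).
    by apply/mem_limg; exists 1; exact: scale1r.
  by rewrite v00 eqxx in vN0.
by have /mem_limg := vT w.
Qed.

Lemma irreducible_fg V : irreducible_mod V -> finitely_generated V.
Proof.
move=> irrV; have [[v vN0] _] := irrV; exists 1, (fun _ => v) => w.
have [a <-] := irreducible_cyclic w irrV vN0.
by exists (fun _ => a); rewrite big_ord1.
Qed.

Lemma schur U V (f : {linear U -> V}) u :
  irreducible_mod U -> irreducible_mod V -> f u != 0 -> bijective f.
Proof.
move=> [_ /(_ (lker_submod f)) kerf] [_ /(_ (limg_submod f)) imf] fu.
apply: inj_surj_bij => [x /mem_lker fx|w].
  by case: kerf => [|/(_ u)/mem_lker fu0]; [apply | rewrite fu0 eqxx in fu].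
case: imf => [/(_ (f u)) fu0|/(_ w)/mem_limg //].
by rewrite fu0 ?eqxx // in fu; apply/mem_limg; exists u.
Qed.

Lemma mod_iso_irreducible U V :
  mod_iso U V -> irreducible_mod U -> irreducible_mod V.
Proof.
case=> f bijf [[u uN0] simU]; have [g fK gK] := bij_inv_linear bijf; split.
  exists (f u); apply: contra_neq uN0 => fu0.
  by rewrite -[u]fK fu0 linear0.
move=> S; have TP : submod_closed (fun x => f x \in S).
  split=> [|a x y xS yS]; first by rewrite -[_ \in _]/(f 0 \in S) linear0 rpred0.
  by rewrite -[_ \in _]/(f (a *: x + y) \in S) linearP rpredD // submodZ.
have [T0|TT] := simU (Submodule TP); [left=> v vS | right=> v].
  by rewrite -[v]gK [g v]T0 ?linear0 // -[_ \in _]/(f (g v) \in S) gK.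
by have : f (g v) \in S := TT (g v); rewrite gK.
Qed.

End Irreducible.

Section Composition.
Variables (k : fieldType) (A : falgType k).
Implicit Types S M N : lmodType A.

Lemma quotient_coords M (b : coords M) (K : submodule M) v :
  v != 0 -> v \in K -> exists b' : coords (lquot K), (cdim b' < cdim b)%N.
Proof.
move=> vN0 vK; have [|b' _] := @span_coords _ _ (lquot K) (cdim b)
    (fun i => lproj K (cbasis b i)).
  move=> x; exists (to_cv b (lrepr x)); rewrite -{1}[x]lreprK.
  under eq_bigr => i _ do rewrite -lproj_is_scalable /=.
  by rewrite -(raddf_sum (lproj K)) /= -cbasis_sum.
exists b'; have piL := klinear_linear (lproj K).
pose X := mx_of b b' (lproj K).
have [Y XY1] : exists Y, X *m Y = 1%:M.
  exists (\matrix_(i, j) to_cv b (lrepr (cbasis b' j)) i 0); apply/matrixP => i j.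
  have -> : (X *m \matrix_(i, j) to_cv b (lrepr (cbasis b' j)) i 0) i j
      = (X *m to_cv b (lrepr (cbasis b' j))) i 0.
    by rewrite !mxE; apply: eq_bigr => l _; rewrite !mxE.
  by rewrite -mx_ofE // lreprK to_cv_cbasis !mxE eqxx andbT.
have Xv : X *m to_cv b v = 0.
  by rewrite -mx_ofE // (iffRL (lproj_eq0 _ _)) ?to_cv0.
have := mulmx0_rank_max Xv.
have rX : (cdim b' <= \rank X)%N by rewrite -[leqLHS](mxrank1 k) -XY1 mxrankM_maxl.
have rv : (0 < \rank (to_cv b v))%N.
  rewrite lt0n mxrank_eq0; apply: contra_neq vN0 => v0.
  by apply: (to_cv_inj (b := b)); rewrite v0 to_cv0.
by move=> le; rewrite (leq_trans _ le) // -addn1 leq_add.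
Qed.

(** Among the nonzero cyclic submodules A s, one of least dimension is
irreducible: each of its nonzero elements generates a submodule of the same
dimension. It is realized as A / Ann(s), which spares a type of submodules. *)
Lemma irreducible_submodule M (b : coords M) (s0 : M) : s0 != 0 ->
  exists2 S : lmodType A, irreducible_mod S & exists i : {linear S -> M}, injective i.
Proof.
move=> s0N0; pose L (s : M) (a : A) := to_cv b (a *: s).
have L_lin s : linear (L s).
  by move=> c x y; rewrite /L scalerDl -mulr_algl -scalerA to_cvP.
pose fL s := sval (linear_map_of (L_lin s)).
have fLE s a : fL s a = to_cv b (a *: s) by rewrite /fL; case: linear_map_of.
(* s minimizes the dimension of A s, measured through the map a |-> a s *)
pose D d := `[< exists2 s : M, s != 0 & \dim (limg (linfun (fL s))) = d >].
have exD : exists d, D d by eexists; apply/asboolP; exists s0.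
have [_ /asboolP[s sN0 <-] dmin] := ex_minnP exD.
exists (lquot (lker_submod (orbit_map s))); last first.
  have [|h hE] := factor_surj (g := orbit_map s)
      (lproj_surj (S := lker_submod (orbit_map s))).
    by move=> v /lproj_eq0/mem_lker.
  exists h; apply: linear_inj => x; rewrite -[x]lreprK hE => sx0.
  by apply/lproj_eq0/mem_lker.
split.
  exists (lproj _ 1); apply/eqP => /lproj_eq0/mem_lker.
  by move=> s00; rewrite -[s]scale1r [1 *: s]s00 eqxx in sN0.
move=> T; have [[x xT xN0]|noT] := pselect (exists2 x, x \in T & x <> 0); last first.
  by left=> x xT; apply: contrapT => xN0; apply: noT; exists x.
right; pose a := lrepr x; have as_N0 : a *: s != 0.
  apply/eqP => as0; apply: xN0; rewrite -[x]lreprK; apply/lproj_eq0.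
  exact/mem_lker.
have sub : (limg (linfun (fL (a *: s))) <= limg (linfun (fL s)))%VS.
  apply/subvP => _ /memv_imgP[c _ ->]; rewrite lfunE /= fLE scalerA -fLE.
  by rewrite -[fL s _]lfunE memv_img ?memvf.
have /dmin le : D (\dim (limg (linfun (fL (a *: s))))).
  by apply/asboolP; exists (a *: s).
have /eqP eqL : limg (linfun (fL (a *: s))) == limg (linfun (fL s)).
  by rewrite eqEdim sub.
have : linfun (fL s) 1 \in limg (linfun (fL (a *: s))) by rewrite eqL memv_img ?memvf.
case/memv_imgP => c _; rewrite !lfunE /= !fLE scale1r => /to_cv_inj sE.
suff T1 : lproj _ 1 \in T.
  move=> v; rewrite -[v]lreprK -[lrepr v]mulr1.
  by rewrite (lproj_is_scalable _ (lrepr v : A) (1 : A^o)) submodZ.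
have -> : lproj (lker_submod (orbit_map s)) 1 = c *: x.
  rewrite -[x]lreprK -lproj_is_scalable; apply/lproj_eq/mem_lker.
  rewrite linearB; apply/eqP; rewrite subr_eq0; apply/eqP.
  rewrite -[LHS]/((1 : A) *: s) -[RHS]/((c * a) *: s).
  by rewrite scale1r -scalerA -sE.
exact: submodZ.
Qed.

(** Induction along a composition series: a nonzero finite-dimensional module
has an irreducible submodule, and the quotient by it has smaller dimension. *)
Lemma composition_ind (Q : lmodType A -> Prop) :
  (forall M, (forall v : M, v = 0) -> Q M) ->
  (forall S M (i : {linear S -> M}),
     irreducible_mod S -> injective i -> Q (lquot (limg_submod i)) -> Q M) ->
  forall M, coords M -> Q M.
Proof.
move=> Q0 QS M b; have [d le_d] := ubnP (cdim b).
elim: d => // d IHd in M b le_d *.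
have [[s sN0]|M0] := pselect (exists s : M, s != 0); last first.
  by apply: Q0 => v; apply/eqP/negPn/negP => vN0; apply: M0; exists v.
have [S irrS [i i_inj]] := irreducible_submodule b sN0.
apply: (QS _ _ i irrS i_inj).
have [[u uN0] _] := irrS.
have iuN0 : i u != 0 by apply: contra_neq uN0 => iu0; apply: i_inj; rewrite iu0 linear0.
have [|b' lt_b'] := @quotient_coords M b (limg_submod i) _ iuN0.
  by apply/mem_limg; exists u.
exact: IHd (leq_trans lt_b' le_d).
Qed.

Lemma regular_fg : finitely_generated (A^o : lmodType A).
Proof.
exists 1, (fun _ => 1) => a; exists (fun _ => a).
by rewrite big_ord1; exact: (esym (mulr1 _)).
Qed.

Lemma rad_act M (a : A) : irreducible_mod M -> a \in Defs.rad A -> forall v : M, a *: v = 0.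
Proof. by move=> irrM /asboolP; apply. Qed.

(** An element of the radical kills each factor of a composition series of A, so
one power of it kills A. *)
Lemma rad_nilpotent (a : A) : a \in Defs.rad A -> exists m, a ^+ m = 0.
Proof.
move=> aR; have [b _] := fg_coords regular_fg.
suff [m /(_ 1)] : exists m, forall v : A^o, (a ^+ m : A) *: v = 0.
  by move=> am; exists m; rewrite -[LHS]mulr1.
move: b; apply: (composition_ind (Q := fun M : lmodType A =>
  exists m, forall v : M, (a ^+ m : A) *: v = 0))
  => [M M0|S M i irrS _ [m am]].
  by exists 0; move=> v; apply: M0.
exists m.+1 => v; have /lproj_eq0/mem_limg[s sE] : lproj (limg_submod i) (a ^+ m *: v) = 0.
  by rewrite linearZ /= am.
by rewrite exprS -scalerA -sE -linearZ /= rad_act ?linear0.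
Qed.

End Composition.

(** * Additivity of traces and ranks on short exact sequences *)

Section Characters.
Variables (k : fieldType) (A : falgType k).
Implicit Types U V W M : lmodType A.

(** The character of M, computed in a given k-basis. *)
Definition act_trace M (b : coords M) (a : A) : k := ktrace b (fun x => a *: x).

(** Preimages of a k-basis of W define s, and i r = 1 - s p then forces r.
Neither map needs to be A-linear. *)
Lemma ses_split U V W (bW : coords W) : short_exact U V W ->
  exists (i : {linear U -> V}) (p : {linear V -> W}) (r : V -> U) (s : W -> V),
    [/\ klinear r, klinear s, forall v, v = i (r v) + s (p v),
        forall u, r (i u) = u & forall w, p (s w) = w].
Proof.
move=> [i [p [i_inj p_surj exact_ip]]].
pose sg j := sval (cid (p_surj (cbasis bW j))).
have sgE j : p (sg j) = cbasis bW j by rewrite /sg; case: cid.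
pose s w := \sum_j ((to_cv bW w j 0)%:A : A) *: sg j.
have ps w : p (s w) = w.
  rewrite linear_sum [RHS](cbasis_sum bW); apply: eq_bigr => j _.
  by rewrite linearZ /= sgE.
have sL : klinear s.
  move=> c x y; rewrite scaler_sumr -big_split; apply: eq_bigr => j _ /=.
  by rewrite to_cvP !mxE scalerDl scalerDl kscaleM.
have r_ex v : exists u, i u = v - s (p v).
  by apply/exact_ip; rewrite linearB ps subrr.
pose r v := sval (cid (r_ex v)).
have rE v : i (r v) = v - s (p v) by rewrite /r; case: cid.
exists i, p, r, s; split=> // [c x y|v|u].
- apply: i_inj; rewrite linearP !rE linearP sL scalerBr opprD.
  by rewrite !addrA; congr (_ + _); rewrite -!addrA; congr (_ + _); rewrite addrC.
- by rewrite rE subrK.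
have pi0 : p (i u) = 0 by apply/exact_ip; exists u.
have s0 : s 0 = 0 by apply: (addrI (s 0)); have := sL 1 0 0; rewrite !scale1r !addr0 => <-.
by apply: i_inj; rewrite rE pi0 s0 subr0.
Qed.

(** In a k-splitting 1 = i r + s p the trace of a on V is that of a i r plus
that of a s p; cyclicity moves the first to U and the second to W, where r a i
and p a s are the actions of a. *)
Lemma act_trace_ses U V W (bU : coords U) (bV : coords V) (bW : coords W) a :
  short_exact U V W -> act_trace bV a = act_trace bU a + act_trace bW a.
Proof.
move=> /(ses_split bW)[i [p [r [s [rL sL irsp ri ps]]]]].
have iL := klinear_linear i; have pL := klinear_linear p.
rewrite /act_trace; set f := fun x : V => a *: x; have fL : klinear f by exact: klinear_act.
have rfL := klinear_comp rL fL; have pfL := klinear_comp pL fL.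
have irfL := klinear_comp iL rfL; have spfL := klinear_comp sL pfL.
have -> : ktrace bV f = ktrace bV (i \o (r \o f)) + ktrace bV (s \o (p \o f)).
  rewrite /ktrace -raddfD; congr (\tr _); apply: mx_of_uniq => v.
  by rewrite mulmxDl -!mx_ofE -?to_cvD -?irsp.
rewrite (ktraceC bV bU) // (ktraceC bV bW) //.
congr (_ + _); apply: eq_ktrace => u; rewrite /f /=.
  by rewrite /f -(linearZZ i); rewrite ri.
by rewrite linearZ /= ps.
Qed.

(** The dimension of e M. Unlike the trace of an idempotent e, this is an
integer also in positive characteristic. *)
Definition act_rank M (b : coords M) (e : A) : nat := \rank (mx_of b b (fun x => e *: x)).

Lemma mx_of1B M (b : coords M) (e : A) :
  mx_of b b (fun x => (1 - e) *: x) = 1%:M - mx_of b b (fun x => e *: x).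
Proof.
apply: mx_of_uniq => v; rewrite mulmxBl mul1mx -mx_ofE //.
by rewrite scalerBl scale1r to_cvB.
Qed.

Lemma mx_ofM M (b : coords M) (x y : A) :
  mx_of b b (fun v => (x * y) *: v)
    = mx_of b b (fun v => x *: v) *m mx_of b b (fun v => y *: v).
Proof.
rewrite -mx_of_comp //.
by apply: eq_mx_of => v; rewrite /= scalerA.
Qed.

Lemma act_rank_compl M (b : coords M) e : e * e = e ->
  (act_rank b e + act_rank b (1 - e)%R)%N = cdim b.
Proof.
move=> ee; apply/eqP; rewrite eqn_leq; apply/andP; split.
  apply: mulmx0_rank_max; rewrite mx_of1B mulmxBr mulmx1 -mx_ofM ee subrr //.
rewrite -[leqLHS](mxrank1 k).
have {1}-> : 1%:M = mx_of b b (fun x => e *: x) + mx_of b b (fun x => (1 - e) *: x).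
  by rewrite mx_of1B addrC subrK.
exact: mxrank_add.
Qed.

(** On V, e = e e = i e (r e) + (e s) e p, with the middle factors acting on U
and on W. *)
Lemma act_rank_ses_le U V W (bU : coords U) (bV : coords V) (bW : coords W) e :
  e * e = e -> short_exact U V W -> (act_rank bV e <= act_rank bU e + act_rank bW e)%N.
Proof.
move=> ee /(ses_split bW)[i [p [r [s [rL sL irsp ri ps]]]]].
have iL := klinear_linear i; have pL := klinear_linear p.
pose E := mx_of bV bV (fun x => e *: x).
pose EU := mx_of bU bU (fun x => e *: x); pose EW := mx_of bW bW (fun x => e *: x).
pose I := mx_of bU bV i; pose P := mx_of bV bW p.
pose r' := mx_of bV bU r; pose s' := mx_of bW bV s.
have -> : act_rank bV e = \rank (I *m EU *m (r' *m E) + E *m s' *m (EW *m P))%R.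
  congr (\rank _); apply: mx_of_uniq => v.
  rewrite mulmxDl -!mulmxA /I /EU /r' /E /s' /EW /P -!mx_ofE //.
  rewrite -to_cvD; congr (to_cv bV _).
  rewrite -{1}ee -scalerA {1}(irsp (e *: v)) scalerDr.
  by rewrite (linearZZ i) (linearZZ p).
apply: leq_trans (mxrank_add _ _) (leq_add _ _).
  by apply: leq_trans (mxrankM_maxl _ _) (mxrankM_maxr _ _).
by apply: leq_trans (mxrankM_maxr _ _) (mxrankM_maxl _ _).
Qed.

(** The inequality holds for e and for 1 - e, and the two ranks add up to the
dimension, which is additive; so both inequalities are equalities. *)
Lemma act_rank_ses U V W (bU : coords U) (bV : coords V) (bW : coords W) e :
  e * e = e -> short_exact U V W -> act_rank bV e = (act_rank bU e + act_rank bW e)%N.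
Proof.
move=> ee ses; have ff : (1 - e) * (1 - e) = 1 - e.
  by rewrite mulrBr mulrBl mul1r mulr1 mulrBl mul1r ee subrr subr0.
have leE := act_rank_ses_le bU bV bW ee ses.
have leF := act_rank_ses_le bU bV bW ff ses.
have dim_le : (cdim bU + cdim bW <= cdim bV)%N.
  have [i [p [r [s [rL sL irsp ri ps]]]]] := ses_split bW ses.
  have iL := klinear_linear i; have pL := klinear_linear p.
  have pi0 u : p (i u) = 0.
    have spi0 : s (p (i u)) = 0.
      by have e1 := irsp (i u); rewrite ri in e1; apply: (addrI (i u)); rewrite -e1 addr0.
    by rewrite -[LHS]ps spi0 linear0.
  have rs0 w : r (s w) = 0.
    have irs0 : i (r (s w)) = 0.
      by have e1 := irsp (s w); rewrite ps in e1; apply: (addIr (s w)); rewrite -e1 add0r.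
    by rewrite -[LHS]ri irs0 -(linear0 i) ri.
  have X1 : col_mx (mx_of bV bU r) (mx_of bV bW p) *m
      row_mx (mx_of bU bV i) (mx_of bW bV s) = 1%:M.
    rewrite mul_col_row -!mx_of_comp // scalar_mx_block.
    congr block_mx; apply: mx_of_uniq => u /=; rewrite ?mul1mx ?mul0mx ?ri ?ps //.
      by rewrite rs0 to_cv0.
    by rewrite pi0 to_cv0.
  rewrite -[leqLHS](mxrank1 k) -X1 (leq_trans (mxrankM_maxl _ _)) //.
  exact: rank_leq_col.
apply/eqP; rewrite eqn_leq leE /= -(leq_add2r (act_rank bV (1 - e))).
rewrite act_rank_compl //; apply: leq_trans dim_le.
by rewrite -(act_rank_compl bU ee) -(act_rank_compl bW ee) addnACA leq_add2l.
Qed.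

End Characters.

(** * The density theorem *)

Section Density.
Variables (R : nzRingType) (I : eqType) (W : I -> lmodType R) (w : forall i, W i).

(** The span of the images of the w_i under all linear maps W_i -> U; the
recursion on l avoids dependent families of maps. *)
Fixpoint hom_span (l : seq I) (U : lmodType R) (u : U) : Prop :=
  if l is i :: l' then exists f : {linear W i -> U}, hom_span l' (u - f (w i))
  else u = 0.

Lemma hom_span_ann l (U : lmodType R) (u : U) a :
  hom_span l u -> (forall i, i \in l -> a *: w i = 0) -> a *: u = 0.
Proof.
elim: l U u => [|i l IHl] U u /= => [-> _|[f fu] al]; first by rewrite scaler0.
have := IHl _ _ fu (fun j jl => al j (@mem_behead _ (i :: l) j jl)).
by rewrite scalerBr -(linearZZ f) al ?mem_head // linear0 subr0.
Qed.

(** By induction on l. Let J be the annihilator of the w_j for j in the tail. If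
J w_i = 0 or some c in J kills w_i but not u, the claim is immediate. Otherwise
J w_i is all of W_i, and c w_i |-> c u for c in J is a well-defined linear map
f; now J kills u - f(w_i), which has to be a sum of images of the w_j by the
induction hypothesis. *)
Lemma jacobson_density l (U : lmodType R) (u : U) :
  (forall i, irreducible_mod (W i)) ->
  hom_span l u \/
  exists a, (forall i, i \in l -> a *: w i = 0) /\ a *: u != 0.
Proof.
move=> irrW; elim: l U u => [|i l IHl] U u /=.
  by case: (eqVneq u 0) => [|uN0]; [left | right; exists 1; rewrite scale1r].
have [lu|[a [al au]]] := IHl U u; first by left; exists \0; rewrite subr0.
have [lw|[b [bl bw]]] := IHl _ (w i).
  right; exists a; split=> // j; rewrite inE => /predU1P[->|]; last exact: al.
  exact: hom_span_ann lw al.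
have [[c [cl cw cu]]|noc] := pselect (exists c,
    [/\ forall j, j \in l -> c *: w j = 0, c *: w i = 0 & c *: u != 0]).
  by right; exists c; split=> // j; rewrite inE => /predU1P[->//|]; apply: cl.
have cwu c : (forall j, j \in l -> c *: w j = 0) -> c *: w i = 0 -> c *: u = 0.
  by move=> cl cw; apply/eqP/negPn/negP => cu; apply: noc; exists c.
have gen x : exists c, (forall j, j \in l -> c *: w j = 0) /\ c *: w i = x.
  have [d <-] := irreducible_cyclic x (irrW i) bw; exists (d * b).
  by split=> [j jl|]; rewrite -scalerA // bl ?scaler0.
pose c x := sval (cid (gen x)).
have cl x : forall j, j \in l -> c x *: w j = 0 by rewrite /c; case: cid => ? [].
have cE x : c x *: w i = x by rewrite /c; case: cid => ? [].
have f_lin : linear (fun x => c x *: u).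
  move=> d x y; apply/subr0_eq; rewrite scalerA -scalerDl -scalerBl.
  apply: cwu => [j jl|]; first by rewrite scalerBl scalerDl -scalerA !cl ?scaler0 ?addr0 ?subr0.
  by rewrite scalerBl scalerDl -scalerA !cE subrr.
have [f fE] := linear_map_of f_lin.
have [lf|[d [dl]]] := IHl U (u - f (w i)); first by left; exists f.
rewrite fE scalerBr scalerA -scalerBl cwu ?eqxx // => [j jl|].
  by rewrite scalerBl -scalerA cl // dl // scaler0 subr0.
by rewrite scalerBl -scalerA cE subrr.
Qed.

End Density.

Section Representatives.
Variables (k : fieldType) (A : falgType k).
Hypothesis k_split : splitting_field A.

Definition std_coords (M : fgmod A) : coords (fgcar M) :=
  sval (cid (fg_coords (fgcar_fg M))).

Definition rho (M : fgmod A) (a : A) := mx_of (std_coords M) (std_coords M) (fun x => a *: x).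

Definition character (M : fgmod A) (a : A) : k := \tr (rho M a).

Lemma rhoE M a x : to_cv (std_coords M) (a *: x) = rho M a *m to_cv (std_coords M) x.
Proof. exact: mx_ofE. Qed.

Lemma rhoM M a b : rho M (a * b) = rho M a *m rho M b.
Proof. exact: mx_ofM. Qed.

Lemma rhoP M c a b : rho M (c *: a + b) = c *: rho M a + rho M b.
Proof.
apply: mx_of_uniq => v; rewrite mulmxDl -scalemxAl -!rhoE.
by rewrite scalerDl -mulr_algl -scalerA to_cvP.
Qed.

Lemma rho_eq0 M a : rho M a = 0 <-> forall v : fgcar M, a *: v = 0.
Proof.
split=> [a0 v|a0]; first by apply: (to_cv_inj (b := std_coords M)); rewrite rhoE a0 mul0mx to_cv0.
by apply: mx_of_uniq => v; rewrite a0 mul0mx to_cv0.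
Qed.

Variables (n : nat) (V : 'I_n -> fgmod A).
Hypothesis irrV : forall i, irreducible_mod (fgcar (V i)).
Hypothesis V_uniq : forall i j, mod_iso (fgcar (V i)) (fgcar (V j)) -> i = j.

Let I : eqType := {j : 'I_n & 'I_(cdim (std_coords (V j)))}.
Let tg j t : I := Tagged (fun j => 'I_(cdim (std_coords (V j)))) (t : 'I_(cdim (std_coords (V j)))).
Let W (p : I) : lmodType A := fgcar (V (tag p)).
Let w (p : I) : W p := cbasis (std_coords (V (tag p))) (tagged p).

(** By Schur's lemma and the splitting hypothesis the linear maps V_j -> V_i are
0 or scalars, so basis vectors other than s contribute nothing to the coordinate
s. *)
Lemma hom_span_coord i (s : 'I_(cdim (std_coords (V i)))) (l : seq I) (u : fgcar (V i)) :
  tg s \notin l -> hom_span w l u -> to_cv (std_coords (V i)) u s 0 = 0.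
Proof.
elim: l u => [|p l IHl] u /=; first by move=> _ ->; rewrite to_cv0 mxE.
rewrite inE negb_or => /andP[sp sl] [f /(IHl _ sl)].
rewrite to_cvB !mxE => /subr0_eq ->.
case: p sp f => j t sp f; rewrite /w /=.
have [ji|ji] := eqVneq j i; last first.
  suff -> : f (cbasis (std_coords (V j)) t) = 0 by rewrite to_cv0 mxE.
  apply: contra_neq_eq ji => fN0; apply: V_uniq; exists f.
  exact: schur (irrV j) (irrV i) fN0.
case: i / ji s u sp sl IHl f => s u sp _ _ f.
have [c ->] := k_split (irrV j) f; rewrite to_cvZ to_cv_cbasis !mxE.
have /negPf-> : s != t by apply: contra_neq sp => ->.
by rewrite mulr0.
Qed.

Lemma density_vector i (s : 'I_(cdim (std_coords (V i)))) (y : fgcar (V i)) :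
  exists a : A, [/\ a *: cbasis (std_coords (V i)) s = y,
    forall t, t != s -> a *: cbasis (std_coords (V i)) t = 0 &
    forall j t, j != i -> a *: cbasis (std_coords (V j)) t = 0].
Proof.
pose l := [seq p : I <- enum {: {j : 'I_n & 'I_(cdim (std_coords (V j)))}} | p != tg s].
have sl : tg s \notin l by rewrite mem_filter eqxx.
have [|ls|[a [al aw]]] := @jacobson_density _ I W w l _ (cbasis (std_coords (V i)) s).
- by move=> p; apply: irrV.
- have := hom_span_coord sl ls; rewrite to_cv_cbasis mxE !eqxx => /eqP.
  by rewrite oner_eq0.
have [b <-] := irreducible_cyclic y (irrV i) aw; exists (b * a); split.
- by rewrite scalerA.
- move=> t ts; rewrite -scalerA; have := al (tg t); rewrite /w /= => ->.
    by rewrite scaler0.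
  rewrite mem_filter mem_enum andbT; apply: contra_neq ts => /eqP.
  by rewrite eq_Tagged /= => /eqP.
move=> j t ji; rewrite -scalerA; have := al (tg t); rewrite /w /= => ->.
  by rewrite scaler0.
by rewrite mem_filter mem_enum andbT; apply: contra_neq ji => /(congr1 tag).
Qed.

(** The density theorem lets an element of A send one basis vector of V_i to a
prescribed column and all other basis vectors of all V_j to 0; summing over the
columns of X gives a. *)
Lemma density_mx i (X : 'M[k]_(cdim (std_coords (V i)))) :
  exists a : A, rho (V i) a = X /\ forall j, j != i -> rho (V j) a = 0.
Proof.
have a_ex s := density_vector s (of_cv (std_coords (V i)) (col s X)).
have [a aP] := choice a_ex.
exists (\sum_s a s); split=> [|j ji]; apply/matrixP => r t; rewrite !mxE scaler_suml.
  rewrite (bigD1 t) //= big1 ?addr0 => [|s st]; last first.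
    by have [_ -> //] := aP s; rewrite eq_sym.
  by have [-> _ _] := aP t; rewrite of_cvK mxE.
rewrite big1 ?to_cv0 ?mxE // => s _.
by have [_ _ ->] := aP s.
Qed.

End Representatives.

(** * Idempotents dual to the irreducible characters *)

Section Idempotents.
Variables (k : fieldType) (A : falgType k).

Lemma mem_radP a : (a \in Defs.rad A) <->
  forall M : lmodType A, irreducible_mod M -> forall v : M, a *: v = 0.
Proof. by split=> [/asboolP|?]; last apply/asboolP. Qed.

(** If (a^2 - a)^N = 0, Bezout in k[X] gives u X^N + v (1 - X)^N = 1, and u(a)
a^N is idempotent. The polynomial u X^N - X vanishes at 0 and at 1, so it is a
multiple of X (1 - X), which a sends into the radical. *)
Lemma idempotent_lift (a : A) : a * a - a \in Defs.rad A ->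
  exists2 e : A, e * e = e & e - a \in Defs.rad A.
Proof.
move=> aR; have [N aN] := rad_nilpotent aR.
(* a positive exponent makes u X^N - X vanish at 0 *)
have {}aN : (a * a - a) ^+ N.+1 = 0 by rewrite exprS aN mulr0.
pose Y : {poly k} := 1 - 'X.
have XY : coprimep ('X : {poly k}) Y.
  by apply/Bezout_eq1_coprimepP; exists (1, 1); rewrite /Y /= !mul1r addrC subrK.
have /Bezout_eq1_coprimepP[[u v] /= uv] : coprimep ('X^(N.+1) : {poly k}) (Y ^+ N.+1).
  by rewrite coprimep_expl // coprimep_expr.
pose f := u * 'X^(N.+1); have f1 : 1 - f = v * Y ^+ N.+1 by rewrite -uv addrC addKr.
have [g gE] : exists g, f - 'X = g * ('X * Y).
  apply/dvdpP; rewrite Gauss_dvdp //; apply/andP; split.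
    by rewrite dvdp_sub // /f exprSr mulrA dvdp_mull.
  have -> : f - 'X = Y - v * Y ^+ N.+1 by rewrite -f1 /Y opprB [RHS]addrC addrA subrK.
  by rewrite dvdp_sub // exprSr mulrA dvdp_mull.
have [h hX] : exists h : {rmorphism {poly k} -> A}, h 'X = a.
  by exists (horner_alg a); apply: horner_algX.
have hXY : h ('X * Y) = - (a * a - a) by rewrite rmorphM rmorphB rmorph1 hX mulrBr mulr1 opprB.
exists (h f); last first.
  have -> : h f - a = (-1 : k) *: (h g * (a * a - a)).
    by rewrite scaleN1r -mulrN -hXY -rmorphM -gE rmorphB hX.
  exact: (@submodZ _ _ (Defs.rad A) (-1) _ (rad_mull _ aR)).
have hf0 : h f * (1 - h f) = 0.
  rewrite -[in 1 - _](rmorph1 h) -rmorphB -rmorphM f1 /f.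
  have -> : u * 'X^(N.+1) * (v * Y ^+ N.+1) = u * v * ('X * Y) ^+ N.+1.
    by rewrite exprMn mulrACA.
  by rewrite rmorphM rmorphXn hXY exprNn aN !mulr0.
by apply/esym/subr0_eq; rewrite -[X in X - _]mulr1 -mulrBr.
Qed.

Hypothesis k_split : splitting_field A.
Variables (n : nat) (V : 'I_n -> fgmod A).

(** Modulo commutators, E_ij with i <> j is E_ii E_ij - E_ij E_ii = 0, and E_ii
= E_is E_si is E_si E_is = E_ss. *)
Lemma mxtrace_char d (W : lmodType k) (F : 'M[k]_d -> W) (s : 'I_d) :
  linear F -> (forall X Y, F (X *m Y) = F (Y *m X)) ->
  forall X, F X = \tr X *: F (delta_mx s s).
Proof.
move=> /linear_map_of[G GE] FC X; rewrite -!GE; rewrite [X in LHS]matrix_sum_delta.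
have GC Y Z : G (Y *m Z) = G (Z *m Y) by rewrite !GE.
rewrite linear_sum scaler_suml; apply: eq_bigr => i _.
rewrite linear_sum (bigD1 i) //= big1 ?addr0 => [|j ji]; last first.
  rewrite linearZ /= -(mul_delta_mx i i j) GC mul_delta_mx_0 ?linear0 ?scaler0 //.
by rewrite linearZ /= -(mul_delta_mx s i i) GC mul_delta_mx.
Qed.

Lemma irreducible_dim i : irreducible_mod (fgcar (V i)) -> (0 < cdim (std_coords (V i)))%N.
Proof.
case=> -[v vN0] _; rewrite lt0n; apply: contra_neq vN0 => d0.
apply: (to_cv_inj (b := std_coords (V i))); apply/colP => j.
by have := ltn_ord j; rewrite [X in (_ < X)%N]d0.
Qed.

Hypothesis repsV : irreducible_reps V.

Let irrV i : irreducible_mod (fgcar (V i)). Proof. by case: repsV. Qed.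
Let uniqV i j : mod_iso (fgcar (V i)) (fgcar (V j)) -> i = j.
Proof. by case: repsV => _ + _; apply. Qed.

Lemma rad_reps a : (forall i, rho (V i) a = 0) -> a \in Defs.rad A.
Proof.
move=> a0; apply/mem_radP => M irrM v; have [_ _ /(_ M irrM)[i [f bijf]]] := repsV.
have [g fK gK] := bij_inv_linear bijf.
by rewrite -[a *: v]fK linearZ /= (iffLR (rho_eq0 _ _) (a0 i)) linear0.
Qed.

Lemma rho_rad i a : a \in Defs.rad A -> rho (V i) a = 0.
Proof. by move=> /mem_radP aR; apply/rho_eq0/aR. Qed.

(** The idempotent e_i lifts an element that acts on V_i as a matrix unit and on
the other V_j as zero. Modulo rad A every a is the sum of elements representing
its actions on the single V_i, and on each of these a trace function is a
multiple of the matrix trace. *)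
Lemma dual_idempotents : exists e : 'I_n -> A,
  [/\ forall i, e i * e i = e i,
      forall i j, character (V j) (e i) = (j == i)%:R,
      forall i j, \rank (rho (V j) (e i)) = (j == i) :> nat &
      forall (W : lmodType k) (T : A -> W), linear T ->
        (forall a b, T (a * b) = T (b * a)) -> (forall a, a \in Defs.rad A -> T a = 0) ->
        forall a, T a = \sum_i character (V i) a *: T (e i)].
Proof.
have [E EP] : exists E : forall i, 'M[k]_(cdim (std_coords (V i))) -> A, forall i X,
    rho (V i) (E i X) = X /\ forall j, j != i -> rho (V j) (E i X) = 0.
  have E_ex i X := density_mx k_split irrV uniqV (i := i) X.
  by exists (fun i X => sval (cid (E_ex i X))) => i X; case: cid.
have EV i X : rho (V i) (E i X) = X by have [] := EP i X.
have E0 i j X : j != i -> rho (V j) (E i X) = 0 by have [_] := EP i X; apply.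
pose s i : 'I_(cdim (std_coords (V i))) := Ordinal (irreducible_dim (irrV i)).
have rhoB i a b : rho (V i) (a - b) = rho (V i) a - rho (V i) b.
  by rewrite -scaleN1r addrC rhoP scaleN1r addrC.
pose eps i := E i (delta_mx (s i) (s i)).
have e_ex i : exists e : A, e * e = e /\ e - eps i \in Defs.rad A.
  have [|e ee eR] := @idempotent_lift (eps i); last by exists e.
  apply: rad_reps => j; rewrite rhoB rhoM.
  have [->|ji] := eqVneq j i; first by rewrite /eps EV mul_delta_mx subrr.
  by rewrite /eps E0 // mulmx0 subrr.
have [e eP] := choice e_ex.
have rho_e i j : rho (V j) (e i) = rho (V j) (eps i).
  by have [_ /(rho_rad j)] := eP i; rewrite rhoB => /subr0_eq.
exists e; split=> [i|i j|i j|W T T_lin TC Trad a].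
- by have [] := eP i.
- rewrite /character rho_e /eps; have [->|ji] := eqVneq j i; last by rewrite E0 ?mxtrace0.
  rewrite EV /mxtrace (bigD1 (s i)) //= big1 ?mxE ?eqxx ?addr0 // => r rs.
  by rewrite mxE (negPf rs).
- rewrite rho_e /eps; have [->|ji] := eqVneq j i; last by rewrite E0 ?mxrank0.
  by rewrite EV mxrank_delta.
have [T' TE] := linear_map_of T_lin.
have Tmod b c : (forall i, rho (V i) b = rho (V i) c) -> T b = T c.
  move=> bc; apply/subr0_eq; rewrite -!TE -linearB TE Trad //.
  by apply: rad_reps => i; rewrite rhoB bc subrr.
have rho_sum j (F : 'I_n -> A) : rho (V j) (\sum_i F i) = \sum_i rho (V j) (F i).
  apply: (big_morph (rho (V j))) => [b c|]; last by apply/rho_eq0 => v; rewrite scale0r.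
  by rewrite -[b]scale1r rhoP !scale1r.
have -> : T a = T (\sum_i E i (rho (V i) a)).
  apply: Tmod => j; rewrite rho_sum (bigD1 j) //= EV big1 ?addr0 // => i ij.
  by rewrite E0 // eq_sym.
rewrite -TE linear_sum; apply: eq_bigr => i _ /=; rewrite !TE.
rewrite (Tmod (e i) (eps i)); last by move=> j; rewrite rho_e.
apply: (mxtrace_char (F := fun X => T (E i X))) => [c X Y|X Y].
  rewrite -TE /= -[RHS]/(c *: T _ + T _) -!TE -linearP !TE.
  apply: Tmod => j; rewrite rhoP.
  have [->|ji] := eqVneq j i; first by rewrite !EV.
  by rewrite !E0 // scaler0 addr0.
have TM Z U : T (E i (Z *m U)) = T (E i Z * E i U).
  apply: Tmod => j; rewrite rhoM; have [->|ji] := eqVneq j i; first by rewrite !EV.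
  by rewrite !E0 // mulmx0.
by rewrite !TM TC.
Qed.

End Idempotents.

Section RepsExist.
Variables (k : fieldType) (A : falgType k).
Hypothesis k_split : splitting_field A.

(** Elements acting nontrivially on exactly one of the V_i are linearly
independent in A. *)
Lemma irreducible_card n (V : 'I_n -> fgmod A) :
  (forall i, irreducible_mod (fgcar (V i))) ->
  (forall i j, mod_iso (fgcar (V i)) (fgcar (V j)) -> i = j) -> (n <= \dim {:A})%N.
Proof.
move=> irrV uniqV.
have a_ex i : exists a : A, rho (V i) a != 0 /\ forall j, j != i -> rho (V j) a = 0.
  have s : 'I_(cdim (std_coords (V i))) := Ordinal (irreducible_dim (irrV i)).
  have [a [aE a0]] := density_mx k_split irrV uniqV (i := i) (delta_mx s s).
  by exists a; split=> //; rewrite aE -mxrank_eq0 mxrank_delta.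
have [a aP] := choice a_ex.
have a_free : free [tuple a i | i < n].
  apply/freeP => c c0 i; apply: contraTeq isT => ci; have [aN0 _] := aP i.
  apply/negP => _; move/negP: aN0; apply; rewrite -(inj_eq (scalerI ci)) scaler0.
  have : rho (V i) (\sum_(j < n) c j *: a j) = 0.
    under eq_bigr => j _ do rewrite -(tnth_mktuple a) (tnth_nth 0).
    by rewrite c0; apply/rho_eq0 => v; rewrite scale0r.
  rewrite (bigD1 i) //= rhoP => /eqP; rewrite [X in _ + X](_ : _ = 0) ?addr0 //.
  apply/rho_eq0 => v; rewrite scaler_suml big1 // => j ji.
  have [_ /(_ i)] := aP j; rewrite eq_sym ji => /(_ isT)/rho_eq0 aj.
  by rewrite -mulr_algl -scalerA aj scaler0.
have := dimvS (subvf <<[tuple a i | i < n]>>%VS).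
by move: a_free; rewrite /free => /eqP ->; rewrite size_tuple.
Qed.

(** A family of pairwise non-isomorphic irreducible modules of maximal size is
complete. *)
Lemma reps_exist : exists n (V : 'I_n -> fgmod A), irreducible_reps V.
Proof.
pose D n := `[< exists V : 'I_n -> fgmod A,
  (forall i, irreducible_mod (fgcar (V i))) /\
  (forall i j, mod_iso (fgcar (V i)) (fgcar (V j)) -> i = j) >].
have D0 : exists n, D n.
  have V0 (i : 'I_0) : fgmod A by case: i.
  by exists 0%N; apply/asboolP; exists V0; split=> -[].
have Dmax n : D n -> (n <= \dim {:A})%N.
  by case/asboolP=> V [irrV uniqV]; apply: irreducible_card irrV uniqV.
have [n /asboolP[V [irrV uniqV]] nmax] := ex_maxnP D0 Dmax.
exists n, V; split=> // S irrS; apply: contrapT => noS.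
have [M MS] := fgmodP (irreducible_fg irrS).
have iso_sym (U W : lmodType A) : mod_iso U W -> mod_iso W U.
  by case=> f /bij_inv_linear[g fK gK]; exists g, f.
have iso_trans (U W X : lmodType A) : mod_iso U W -> mod_iso W X -> mod_iso U X.
  by move=> [f bf] [g bg]; exists (g \o f); apply: bij_comp.
suff /nmax : D n.+1 by rewrite ltnn.
apply/asboolP; exists (fun i => if unlift ord_max i is Some j then V j else M).
split=> [i|i j].
  case: unliftP => [j _|_]; first exact: irrV.
  exact: mod_iso_irreducible (iso_sym _ _ MS) irrS.
case: unliftP => [i' ->|->]; case: unliftP => [j' ->|->] // iso.
- by rewrite (uniqV _ _ iso).
- by case: noS; exists i'; apply: iso_trans (iso_sym _ _ MS) (iso_sym _ _ iso).
by case: noS; exists j'; apply: iso_trans (iso_sym _ _ MS) iso.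
Qed.

End RepsExist.

(** * Projective modules and the Higman trace *)

Section Projective.
Variable R : nzRingType.

(** A splitting of a surjection R^r -> P gives the coordinate functions f_i. *)
Lemma projective_dual_basis (P : lmodType R) : finitely_generated P -> projective_mod P ->
  exists r (f : 'I_r -> {linear P -> R^o}) (g : 'I_r -> P),
    forall p, p = \sum_i (f i p : R) *: g i.
Proof.
case=> r [g gP] projP.
have [|G GE] := @linear_map_of _ _ _ (fun u : 'rV[R]_r => \sum_i u 0 i *: g i).
  move=> a u v; rewrite scaler_sumr -big_split; apply: eq_bigr => i _.
  by rewrite !mxE scalerDl scalerA.
have [|h hE] := projP _ _ G (idfun : {linear P -> P}).
  move=> v; have [a aE] := gP v; exists (\row_i a i); rewrite GE aE.
  by apply: eq_bigr => i _; rewrite mxE.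
have f_lin i : linear (fun p => h p 0 i : R^o) by move=> a u v; rewrite linearP !mxE.
exists r, (fun i => sval (linear_map_of (f_lin i))), g => p; rewrite -[LHS]hE GE.
by apply: eq_bigr => i _; case: linear_map_of => f fE /=; rewrite fE.
Qed.

Lemma dual_basis_projective (P : lmodType R) (f : {linear P -> R^o}) (g : P) :
  (forall p, p = (f p : R) *: g) -> projective_mod P.
Proof.
move=> fg M N u v u_surj; have [m um] := u_surj (v g).
have [|h hE] := @linear_map_of _ _ _ (fun p => (f p : R) *: m).
  by move=> a x y; rewrite linearP scalerDl -scalerA.
by exists h => p; rewrite hE (linearZZ u) um -(linearZZ v) -fg.
Qed.

End Projective.

Section HigmanTrace.
Variables (k : fieldType) (A : falgType k).

Definition regular_coords : coords (A^o : lmodType A) := sval (cid (fg_coords (@regular_fg k A))).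

Definition lrmul (c a : A) (z : A^o) : A^o := c * z * a.

Lemma klinear_lrmul c a : klinear (lrmul c a).
Proof.
move=> d x y; rewrite /lrmul -![_%:A *: _]/(_%:A * _) !mulr_algl mulrDr mulrDl.
by rewrite -scalerAr -scalerAl.
Qed.

Definition lrtrace (c a : A) : k := ktrace regular_coords (lrmul c a).

(** Left and right multiplications commute, so composing two such maps in either
order exchanges the products on both sides. *)
Lemma lrtrace_comp c c' a a' : lrtrace (c * c') (a' * a) = lrtrace (c' * c) (a * a').
Proof.
rewrite /lrtrace (@eq_ktrace _ _ _ regular_coords _ (lrmul c a \o lrmul c' a')).
  rewrite (ktraceC regular_coords regular_coords); try exact: klinear_lrmul.
  by apply: eq_ktrace => z; rewrite /lrmul /= !mulrA.
by move=> z; rewrite /lrmul /= !mulrA.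
Qed.

Lemma lrtraceCr c a b : lrtrace c (a * b) = lrtrace c (b * a).
Proof. by have := lrtrace_comp c 1 b a; rewrite mulr1 mul1r. Qed.

Lemma lrtraceCl c d a : lrtrace (c * d) a = lrtrace (d * c) a.
Proof. by have := lrtrace_comp c d a 1; rewrite mulr1 mul1r. Qed.

Lemma lrtrace_nilpotent m c a : (c ^+ m = 0 \/ a ^+ m = 0) -> lrtrace c a = 0.
Proof.
move=> ca0; apply: (@mxtrace_nilpotent _ m).
have -> j : mx_of regular_coords regular_coords (lrmul c a) ^+ j
    = mx_of regular_coords regular_coords (lrmul (c ^+ j) (a ^+ j)).
  elim: j => [|j IHj].
    apply/esym/mx_of_uniq => z; rewrite expr0 mul1mx.
    by rewrite /lrmul !expr0 mul1r mulr1.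
  rewrite exprS IHj -mulmxE -mx_of_comp; try exact: klinear_lrmul.
  by apply: eq_mx_of => z; rewrite /lrmul /= exprS exprSr !mulrA.
apply: mx_of_uniq => z; rewrite mul0mx /lrmul.
by case: ca0 => ->; rewrite ?mulr0 ?mul0r to_cv0.
Qed.

Lemma lrtrace_radr c a : a \in Defs.rad A -> lrtrace c a = 0.
Proof. by case/rad_nilpotent => m am; apply: (@lrtrace_nilpotent m); right. Qed.

Lemma lrtrace_radl c a : c \in Defs.rad A -> lrtrace c a = 0.
Proof. by case/rad_nilpotent => m cm; apply: (@lrtrace_nilpotent m); left. Qed.

(** The action of c on P is the sum of the maps p |-> f_i(c p) g_i. Each factors
through A, and composing in the other order gives z |-> c z f_i(g_i). *)
Lemma act_trace_dual_basis (P : lmodType A) (b : coords P) r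
    (f : 'I_r -> {linear P -> A^o}) (g : 'I_r -> P) c :
  (forall p, p = \sum_i (f i p : A) *: g i) ->
  act_trace b c = lrtrace c (\sum_i (f i (g i) : A)).
Proof.
move=> fg; pose F i (p : P) : A^o := f i (c *: p).
have FL i : klinear (F i).
  by move=> d x y; rewrite /F [c *: _]klinear_act klinear_linear.
rewrite /act_trace (@eq_ktrace _ _ _ b _ (fun p => \sum_i (orbit_map (g i) \o F i) p)).
  rewrite ktrace_sum /lrtrace.
  rewrite (@eq_ktrace _ _ _ _ _ (fun z => \sum_i (F i \o orbit_map (g i)) z)).
    rewrite ktrace_sum; apply: eq_bigr => i _.
    exact: (ktraceC b regular_coords (FL i) (klinear_linear (orbit_map (g i)))).
  move=> z; rewrite /lrmul mulr_sumr; apply: eq_bigr => i _ /=.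
  by rewrite /F /orbit_map scalerA (linearZZ (f i)).
by move=> p; rewrite [c *: p in LHS]fg.
Qed.

Variables (beta : {biscalar A}) (m : nat) (x y : 'I_m -> A).
Hypotheses (beta_assoc : associative_form beta) (beta_nonsing : nonsingular_form beta).
Hypothesis xy_dual : dual_bases x y beta.

Local Notation tau := (higman_trace x y).

(** The dual bases express the map z |-> c z a as the sum of the rank one maps z
|-> beta(z, y_i) c x_i a, whose traces are beta(c x_i a, y_i). *)
Lemma beta_higman c a : beta c (tau a) = lrtrace c a.
Proof.
rewrite /lrtrace (@eq_ktrace _ _ _ _ _
    (fun z : A^o => \sum_i ((beta (z : A) (y i))%:A : A) *: (c * x i * a : A^o))).
  rewrite ktrace_sum /higman_trace linear_sumr; apply: eq_bigr => i _.
  rewrite ktrace_rank1 => [|d u v]; last first.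
    by rewrite [(d%:A : A) *: u](mulr_algl d (u : A)) linearPl.
  by rewrite [RHS]beta_assoc [RHS]beta_assoc mulrA.
move=> z; rewrite /lrmul [in LHS](xy_dual z) mulr_sumr mulr_suml.
apply: eq_bigr => i _; rewrite -scalerAr -scalerAl.
by rewrite [RHS]mulr_algl.
Qed.

Lemma beta_inj u v : (forall c, beta c u = beta c v) -> u = v.
Proof.
have [L LE] : exists L : A -> {linear A -> k^o}, forall w c, L w c = beta c w.
  have L_lin w : linear (fun c => beta c w : k^o) by move=> d s t; rewrite linearPl.
  by exists (fun w => sval (linear_map_of (L_lin w))) => w c; case: linear_map_of.
have linfunE w : linfun (fun c => beta c w : k^o) = linfun (L w).
  by congr linfun; apply: funext => c; rewrite LE.
move=> uv; apply: (bij_inj beta_nonsing); apply/lfunP => c.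
by rewrite !linfunE !lfunE /= !LE uv.
Qed.

Lemma higmanC a b : tau (a * b) = tau (b * a).
Proof. by apply: beta_inj => c; rewrite !beta_higman lrtraceCr. Qed.

Lemma higman_rad a : a \in Defs.rad A -> tau a = 0.
Proof. by move=> aR; apply: beta_inj => c; rewrite beta_higman lrtrace_radr // linear0r. Qed.

(** For c in rad A, beta(b, c tau(a)) = lrtrace (b c) a = 0 for all b. *)
Lemma rad_higman c a : c \in Defs.rad A -> c * tau a = 0.
Proof.
move=> cR; apply: beta_inj => b; rewrite linear0r -beta_assoc beta_higman.
by rewrite lrtrace_radl // rad_mull.
Qed.

Lemma lrtrace_linearl a : linear (fun c => lrtrace c a : k^o).
Proof. by move=> d u v; rewrite -!beta_higman linearPl. Qed.

Lemma lrtrace_linearr c : linear (fun a => lrtrace c a : k^o).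
Proof. by move=> d u v; rewrite -!beta_higman linearP linearPr. Qed.

End HigmanTrace.

Section PrincipalModule.
Variables (k : fieldType) (A : falgType k).

(** The module A e, realized as the quotient of A by the left annihilator of e;
x |-> x e is then the coordinate function dual to the class of 1. *)
Lemma principal_projective (e : A) : e * e = e ->
  exists P : fgproj A, forall c, character (val P) c = lrtrace c e.
Proof.
move=> ee; have [|psi psiE] := @linear_map_of A 'rV[A]_1 A^o (fun u => u 0 0 * e).
  by move=> a u v; rewrite !mxE mulrDl -mulrA.
pose M := FgMod (lker_submod psi).
have [|f fE] := factor_surj (g := psi) (lproj_surj (S := lker_submod psi)).
  by move=> v /lproj_eq0/mem_lker.
pose g : fgcar M := lproj (lker_submod psi) (const_mx 1).
have fg p : p = (f p : A) *: g.
  rewrite -[p]lreprK fE -lproj_is_scalable; apply/lproj_eq/mem_lker.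
  rewrite linearB (linearZZ psi) !psiE -[_ *: _]/(_ * (_ * _)) mxE mul1r.
  by rewrite -mulrA ee subrr.
have projM : projective_mod (fgcar M) := dual_basis_projective fg.
have MP : `[< projective_mod (fgcar M) >] by apply/asboolP.
exists (exist _ M MP : fgproj A) => c.
have -> : e = \sum_(i < 1) (f g : A).
  by rewrite big_ord1 fE psiE mxE mul1r.
apply: (@act_trace_dual_basis _ _ _ (std_coords M) 1 (fun=> f) (fun=> g) c) => p.
by rewrite big_ord1.
Qed.

End PrincipalModule.

(** * Semisimple algebras *)

Section Semisimple.
Variable R : nzRingType.

(** Let V = A v with annihilator K, and 1 = s + t along a decomposition of the
regular module as K and a complement. Then K t = 0, so a v |-> a t is a
well-defined coordinate function dual to v. *)
Lemma semisimple_projective (V : lmodType R) :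
  semisimple_ring R -> irreducible_mod V -> projective_mod V.
Proof.
move=> ssR irrV; have [[v vN0] _] := irrV.
have [T [KT0 KT]] := ssR (lker_submod (orbit_map v)).
have [s /mem_lker sv tT] := KT 1; set t : R^o := 1 - s in tT.
have tv : (t : R) *: v = v.
  have sv0 : (s : R) *: v = 0 by [].
  by rewrite scalerBl scale1r sv0 subr0.
have [| |f fE] := factor_surj (f := orbit_map v) (g := orbit_map t).
- by move=> w; have [a <-] := irreducible_cyclic w irrV vN0; exists a.
- move=> x xv; apply: KT0; last exact: submodZ.
  by apply/mem_lker; rewrite -[LHS]/((x * t) *: v) -scalerA tv.
apply: (@dual_basis_projective _ V f v) => w.
have [a <-] := irreducible_cyclic w irrV vN0.
have -> : f (a *: v) = a *: t by exact: (fE a).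
by rewrite -[RHS]/((a * t) *: v) -scalerA tv.
Qed.

(** A section of P -> V has an image that supplements the kernel; as the kernel
is superfluous, this image is P. *)
Lemma projective_cover_iso (P V : lmodType R) :
  projective_cover P V -> projective_mod V -> mod_iso P V.
Proof.
move=> [_ [f [f_surj f_sup]]] projV.
have [h fh] := projV _ _ f (idfun : {linear V -> V}) f_surj.
have h_surj p : exists v, h v = p.
  apply/mem_limg/f_sup => q; exists (h (f q)); first by apply/mem_limg; exists (f q).
  by rewrite linearB fh subrr.
exists f; apply: inj_surj_bij => // p.
by have [v <-] := h_surj p; rewrite fh /= => ->; rewrite linear0.
Qed.

End Semisimple.

Section SemisimpleRad.
Variables (k : fieldType) (A : falgType k).

(** If 1 - s lies in a complement of rad A with s in rad A, then b = b s for all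
b in rad A, and s is nilpotent. *)
Lemma semisimple_rad0 : semisimple_ring A -> forall a, a \in Defs.rad A -> a = 0.
Proof.
have radP : submod_closed ((fun a => a \in Defs.rad A) : {pred A^o}).
  split=> [|c u v uR vR]; first exact: rpred0.
  by apply: (rpredD (S := Defs.rad A)) => //; apply: rad_mull.
case/(_ (Submodule radP)) => T [RT0 RT] a aR.
have [s sR tT] := RT 1; have [m sm] := rad_nilpotent sR.
have as_a b : b \in Defs.rad A -> b = b * s.
  move=> bR; apply/subr0_eq; apply: RT0; last first.
    by have := submodZ b tT; rewrite scalerBr -[b *: 1]/(b * 1) mulr1.
  by apply: (rpredB (S := Defs.rad A)) => //; apply: rad_mulr.
suff asm j : a = a * s ^+ j by rewrite (asm m) sm mulr0.
elim: j => [|j IHj]; first by rewrite mulr1.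
by rewrite exprS mulrA -as_a.
Qed.

(** A left ideal U of least dimension with S + U = A is a complement of S. For
if 0 <> s lies in S and U, then s v <> 0 for some v in an irreducible V, so (S
and U) v = V, and the elements of U that kill v are still enough to supplement
S. *)
Lemma rad0_semisimple : (forall a, a \in Defs.rad A -> a = 0) -> semisimple_ring A.
Proof.
move=> rad0 S.
pose compl (U : {vspace A}) := (forall a u, u \in U -> a * u \in U) /\
  forall v : A^o, exists2 s, s \in S & v - s \in U.
pose D d := `[< exists2 U, compl U & \dim U = d >].
have exD : exists d, D d.
  eexists; apply/asboolP; exists fullv => //; split=> [a u _|v]; first exact: memvf.
  by exists 0; [exact: (submodP S).1 | exact: memvf].
have [_ /asboolP[U [UM US] <-] dmin] := ex_minnP exD.
have UP : submod_closed ((fun u => u \in U) : {pred A^o}).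
  split=> [|a u v uU vU]; first exact: mem0v.
  by apply: memvD => //; apply: UM.
exists (Submodule UP); split=> // s sS sU; apply: contrapT => sN0.
have [V [irrV [v sv]]] : exists V : lmodType A, irreducible_mod V /\ exists v : V, s *: v <> 0.
  apply: contrapT => noV; apply/sN0/rad0/mem_radP => V irrV v.
  by apply: contrapT => sv; apply: noV; exists V; split=> //; exists v.
have [b _] := fg_coords (irreducible_fg irrV).
have [|L LE] := @linear_map_of _ _ _ (fun a : A => to_cv b (a *: v)).
  by move=> c x y; rewrite scalerDl -mulr_algl -scalerA to_cvP.
pose U' := (U :&: lker (linfun L))%VS.
have U'P a : (a \in U') = (a \in U) && (a *: v == 0).
  rewrite memv_cap memv_ker lfunE /= LE; congr (_ && _).
  by rewrite -(to_cv0 b) (inj_eq (to_cv_inj (b := b))).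
suff /dmin : D (\dim U').
  rewrite leqNgt (ltn_leqif (dimv_leqif_sup (capvSl _ _))) => /negP; apply.
  by apply/subvP => /(_ s sU); rewrite -/U' U'P sU /= => /eqP.
apply/asboolP; exists U' => //; split=> [a u|x].
  by rewrite !U'P => /andP[uU /eqP uv]; rewrite UM // -scalerA uv scaler0 eqxx.
have [s1 s1S tU] := US x.
have [c cE] := irreducible_cyclic ((x - s1 : A) *: v) irrV (introN eqP sv).
exists (s1 + c *: s).
  by apply: rpredD => //; apply: submodZ.
rewrite opprD addrA U'P scalerBl -[(c *: s) *: v]scalerA cE subrr eqxx andbT.
by apply: memvB => //; apply: UM.
Qed.

End SemisimpleRad.

(** * The Grothendieck group of finitely generated modules *)

Section GrothendieckGroup.
Variables (k : fieldType) (A : falgType k).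

Lemma G0_ses (U V W : fgmod A) :
  short_exact (fgcar U) (fgcar V) (fgcar W) -> G0_class V = G0_class U + G0_class W.
Proof.
move=> UVW; apply/eqP; rewrite addrC -subr_eq; apply/eqP.
rewrite /G0_class /groth_class -raddfB; apply/gproj_eq/mem_gen.
by exists U, V, W.
Qed.

Lemma G0_zero (M : fgmod A) : (forall v : fgcar M, v = 0) -> G0_class M = 0.
Proof.
move=> M0; apply: (addrI (G0_class M)); rewrite addr0 -(@G0_ses M M M) //.
exists idfun, idfun; split=> // [v|v]; first by exists v.
by split=> _; [exists v | exact: M0].
Qed.

Lemma G0_iso (M N : fgmod A) : mod_iso (fgcar M) (fgcar N) -> G0_class M = G0_class N.
Proof.
case=> f [g fK gK]; pose Z : fgmod A := FgMod (lker_submod (\0 : {linear 'rV[A]_0 -> A^o})).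
have Z0 (z : fgcar Z) : z = 0 by rewrite -[z]lreprK; apply/lproj_eq0/mem_lker.
rewrite (@G0_ses Z M N) ?(G0_zero Z0) ?add0r //.
exists \0, f; split=> [u v _|w|v]; first by rewrite [u]Z0 [v]Z0.
  by exists (g w); rewrite gK.
by split=> [fv|[u <-]]; [exists 0; rewrite -[v]fK fv -(linear0 f) fK | rewrite linear0].
Qed.

Lemma character_lift (a : A) : exists h : {additive G0 A -> k},
  forall M, h (G0_class M) = character M a.
Proof.
apply: groth_lift => U V W UVW; exact: (act_trace_ses (std_coords U) (std_coords V) (std_coords W)).
Qed.

Lemma rank_lift (e : A) : e * e = e -> exists h : {additive G0 A -> int},
  forall M, h (G0_class M) = (\rank (rho M e))%:Z.
Proof.
move=> ee; apply: groth_lift => U V W UVW; rewrite -PoszD; congr Posz.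
exact: (act_rank_ses (std_coords U) (std_coords V) (std_coords W)).
Qed.

Lemma finitely_generated_surj (R : nzRingType) (M N : lmodType R) (f : {linear M -> N}) :
  surjective f -> finitely_generated M -> finitely_generated N.
Proof.
move=> f_surj [n [g gP]]; exists n, (fun i => f (g i)) => v.
have [u <-] := f_surj v; have [a ->] := gP u; exists a.
by rewrite linear_sum; apply: eq_bigr => i _; rewrite linearZ.
Qed.

(** The first factor of a composition series of M is some V_j, and the class of
the quotient is known by induction. *)
Lemma G0_span n (V : 'I_n -> fgmod A) (M : fgmod A) : irreducible_reps V ->
  exists c : 'I_n -> int, G0_class M = \sum_i G0_class (V i) *~ c i.
Proof.
move=> [_ _ repsV].
suff : forall N : lmodType A, coords N -> forall M, mod_iso (fgcar M) N ->
    exists c : 'I_n -> int, G0_class M = \sum_i G0_class (V i) *~ c i.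
  by move/(_ _ (std_coords M) M); apply; exists idfun, idfun.
move=> {M}; apply: composition_ind => [N N0 M [f [g fK _]]|S N i irrS i_inj IH M [f f_bij]].
  exists (fun _ => 0); rewrite big1 // G0_zero // => v.
  by rewrite -[v]fK [f v]N0 -[0](N0 (f 0)) fK.
have [g fK gK] := bij_inv_linear f_bij.
pose Q := lquot (limg_submod i).
have pf_surj : surjective (lproj (limg_submod i) \o f).
  by move=> q; exists (g (lrepr q)); rewrite /= gK lreprK.
have [M' M'Q] := fgmodP (finitely_generated_surj pf_surj (fgcar_fg M)).
have [c cE] := IH M' M'Q; have [j [s s_bij]] := repsV S irrS.
have [t sK tK] := bij_inv_linear s_bij.
have [h [h' hK h'K]] := M'Q; have [h'' hK'' h''K] := bij_inv_linear (Bijective hK h'K).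
exists (fun l => (l == j)%:Z + c l).
rewrite (@G0_ses (V j) M M').
  under eq_bigr => l _ do rewrite mulrzDr.
  rewrite big_split /= -cE; congr (_ + _).
  by rewrite (bigD1 j) //= eqxx mulr1z big1 ?addr0 // => l /negPf->; rewrite mulr0z.
exists (g \o (i \o t)), (h'' \o (lproj (limg_submod i) \o f)); split=> /=.
- move=> u v /= /(can_inj gK)/i_inj; exact: (can_inj tK).
- move=> v; have [u uE] := pf_surj (h v); exists u.
  by rewrite /= in uE; rewrite /= uE hK''.
move=> v; split=> [e0|[u <-]].
  have /lproj_eq0/mem_limg[w wE] : lproj (limg_submod i) (f v) = 0.
    by rewrite -[LHS]h''K e0 linear0.
  by exists (s w); rewrite /= sK wE fK.
by rewrite /= gK (iffRL (lproj_eq0 _ _)) ?linear0 //; apply/mem_limg; exists (t u).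
Qed.

End GrothendieckGroup.

(** In finite dimension an injective right multiplication is surjective. *)
Lemma injective_unit (k : fieldType) (A : falgType k) (u : A) :
  (forall w, w * u = 0 -> w = 0) -> u \is a GRing.unit.
Proof.
move=> u_inj.
have inj_u : lker (amulr u) == 0%VS.
  by apply/lker0P => a b; rewrite !lfunE /= => ab; apply/subr0_eq/u_inj; rewrite mulrBl ab subrr.
have : 1 \in limg (amulr u) by rewrite lker0_limgf ?memvf.
case/memv_imgP => w _; rewrite lfunE /= => wu1.
apply/unitrP; exists w; split=> //; apply/subr0_eq/u_inj.
by rewrite mulrBl -mulrA -wu1 mulr1 mul1r subrr.
Qed.

Lemma intr_eq0_char_divides (k : fieldType) (d : int) :
  d%:~R = 0 :> k <-> char_divides k d.
Proof.
have dE : (d%:~R == 0 :> k) = (`|d|%N%:R == 0 :> k).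
  by case: d => j //; rewrite NegzE mulrNz oppr_eq0 abszN.
split=> [/eqP|[[p pP pd]|[_ ->//]]]; last first.
  by apply/eqP; rewrite dE -(dvdn_pcharf pP); move: pd; rewrite dvdzE.
rewrite dE => d0; have [[p pP]|noP] := pselect (exists p, p \in [pchar k]).
  by left; exists p => //; rewrite dvdzE (dvdn_pcharf pP).
right; split=> [p|]; first by apply/negP => pP; apply: noP; exists p.
have [/eqP|dpos] := posnP `|d|%N; first by rewrite absz_eq0 => /eqP.
by case: noP; apply: natf0_pchar dpos d0.
Qed.

Section RankFormula.
Variables (k : fieldType) (A : falgType k) (beta : {biscalar A}).
Variables (m : nat) (x y : 'I_m -> A).
Hypotheses (beta_assoc : associative_form beta) (beta_nonsing : nonsingular_form beta).
Hypotheses (xy_dual : dual_bases x y beta) (k_split : splitting_field A).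

Local Notation tau := (higman_trace x y).
Local Notation beta_tau := (beta_higman beta_assoc xy_dual).

Lemma projective_character (P : fgproj A) :
  exists p : A, forall c, character (val P) c = lrtrace c p.
Proof.
have projP : projective_mod (fgcar (val P)) by apply/asboolP/(valP P).
have [r [f [g fg]]] := projective_dual_basis (fgcar_fg (val P)) projP.
exists (\sum_i (f i (g i) : A)) => c.
exact: (act_trace_dual_basis (std_coords (val P)) c fg).
Qed.

(** The class map theta(u) = sum_i beta(e_i, u) [V_i] (x) 1 identifies the image
of tau with that of the Cartan map. It is injective there because c |-> beta(c,
tau(a)) is a trace function killed by rad A, hence is determined by its values
on the e_i. *)
Lemma cartan_rank : has_rank (tens_map k (cartan A)) (\dim (limg (linfun tau))).
Proof.
have [n [V repsV]] := reps_exist k_split.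
have [e [ee chi_e _ traceE]] := dual_idempotents k_split repsV.
pose vT i : tens k (G0 A) := pure_tens (G0_class (V i)) 1.
have [theta thetaE] : exists theta : {linear A -> tens k (G0 A)},
    forall u, theta u = \sum_i beta (e i) u *: vT i.
  have [|h hE] := @linear_map_of _ _ _ (fun u : A => \sum_i beta (e i) u *: vT i); last by exists h.
  move=> c u v; rewrite scaler_sumr -big_split; apply: eq_bigr => i _ /=.
  by rewrite linearPr scalerDl scalerA.
(* the coefficient of [V_i] in [M], an integer, is chi_M(e_i) in k *)
have theta_class M u : (forall c, character M c = beta c u) ->
    pure_tens (G0_class M) 1 = theta u.
  move=> chiM; have [c cE] := G0_span M repsV.
  rewrite cE pure_tens_sum thetaE; apply: eq_bigr => i _.
  rewrite pure_tensMz -chiM; congr (_ *: _).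
  have [h hE] := character_lift (e i); rewrite -hE cE raddf_sum (bigD1 i) //= big1.
    by rewrite addr0 raddfMz hE chi_e eqxx.
  by move=> j ji; rewrite raddfMz hE chi_e (negPf ji) mul0rz.
have theta_inj a : theta (tau a) = 0 -> tau a = 0.
  move=> th0; apply: (beta_inj beta_nonsing) => c; rewrite linear0r beta_tau.
  rewrite (traceE k^o (fun c => lrtrace c a)).
  - apply: big1 => i _; suff -> : lrtrace (e i) a = 0 by rewrite scaler0.
    have [h hE] := character_lift (e i); have [D DE] := tens_lift (h : {additive G0 A -> k^o}).
    have thD w : D (theta w) = beta (e i) w.
      rewrite thetaE (linear_sum D) (bigD1 i) //= big1 => [|j ji].
        by rewrite addr0 (linearZZ D) DE scale1r hE chi_e eqxx -[LHS]/(_ * 1) mulr1.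
      by rewrite (linearZZ D) DE scale1r hE chi_e (negPf ji) scaler0.
    by rewrite -beta_tau -thD th0 linear0.
  - exact: (lrtrace_linearl beta_assoc xy_dual).
  - by move=> b d; exact: (lrtraceCl b d a).
  - by move=> b bR; exact: (lrtrace_radl a bR).
have theta_pure (z : K0 A) : exists a, pure_tens (cartan A z) 1 = theta (tau a).
  elim/groth_ind: z => [u v [a ua] [b vb]|P|].
  - exists (a - b); rewrite (raddfB (cartan A)) pure_tensB ua vb.
    by rewrite -linearB -(raddfB (higman_trace x y)).
  - have [p pE] := projective_character P; exists p.
    rewrite -[groth_class _ _]/(K0_class P) cartanE; apply: theta_class => c.
    by rewrite beta_tau.
  by exists 0; rewrite !raddf0 pure_tens0.
have theta_image u : exists a, tens_map k (cartan A) u = theta (tau a).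
  elim/tens_ind: u => [|c u v [a ua] [b vb]|z].
  - by exists 0; rewrite !linear0.
  - by exists (c *: a + b); rewrite tens_map_linear ua vb higman_trace_linear linearP.
  by have [a za] := theta_pure z; exists a; rewrite tens_mapE.
have image_theta a : exists u, tens_map k (cartan A) u = theta (tau a).
  have P_ex i := principal_projective (ee i).
  have [P PE] := choice P_ex.
  exists (\sum_i character (V i) a *: pure_tens (K0_class (P i)) 1).
  rewrite (traceE A tau); first last.
  - exact: (higman_rad beta_assoc beta_nonsing xy_dual).
  - exact: (higmanC beta_assoc beta_nonsing xy_dual).
  - exact: higman_trace_linear.
  rewrite !linear_sum; apply: eq_bigr => i _; rewrite !linearZ /= tens_mapE.
  congr (_ *: _); rewrite -(theta_class (val (P i))) => [|c]; last by rewrite PE beta_tau.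
  by congr pure_tens; apply: cartanE.
pose L := limg (linfun tau).
have LP w : w \in L -> exists a, w = tau a.
  by case/memv_imgP => a _ ->; exists a; rewrite lfunE.
have tauL a : tau a \in L by rewrite -[tau a]lfunE memv_img ?memvf.
exists (fun t => theta (vbasis L)`_t); split=> [t|a a0 t|u].
- have [|a ->] := @LP (vbasis L)`_t; last exact: image_theta.
  by apply: vbasis_mem; rewrite mem_nth // size_tuple.
- pose w := \sum_t a t *: (vbasis L)`_t.
  have wL : w \in L.
    apply: memv_suml => j _; apply: memvZ.
    by apply: vbasis_mem; rewrite mem_nth // size_tuple.
  have w0 : w = 0.
    have [b wb] := LP w wL; rewrite wb; apply: theta_inj.
    by rewrite -wb linear_sum -[RHS]a0; apply: eq_bigr => j _; rewrite linearZ.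
  have /freeP := basis_free (vbasisP L); exact.
have [a ua] := theta_image u; exists (fun t => coord (vbasis L) t (tau a)).
rewrite [LHS]ua {1}(coord_vbasis (tauL a)) linear_sum; apply: eq_bigr => t _.
by rewrite linearZ.
Qed.

Section CartanMatrix.
Variables (n : nat) (V : 'I_n -> fgmod A) (P : 'I_n -> fgproj A) (C : 'M[int]_n).
Variable ttau : {linear Tspace (Arad A) -> A}.
Hypotheses (repsV : irreducible_reps V) (coverP : projective_covers V P).
Hypotheses (cartanC : is_cartan_matrix V P C) (ttauP : induced_trace x y ttau).

Lemma cartan_character j c :
  character (val (P j)) c = \sum_i character (V i) c *~ C i j.
Proof.
have [h hE] := character_lift c; rewrite -hE -cartanE cartanC raddf_sum.
by apply: eq_bigr => i _; rewrite raddfMz hE.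
Qed.

(** Characters only determine C modulo the characteristic; the functions M |->
dim e_i M on [G0] determine its integer entries. *)
Lemma semisimple_cartan1 : semisimple_ring A -> C = 1%:M.
Proof.
move=> ssA; have [irrV _ _] := repsV.
have [e [ee _ rank_e _]] := dual_idempotents k_split repsV.
have PV j : G0_class (val (P j)) = G0_class (V j).
  apply/G0_iso/projective_cover_iso; first exact: coverP.
  exact: semisimple_projective.
apply/matrixP => i j; rewrite !mxE; have [h hE] := rank_lift (ee i).
have := congr1 h (cartanC j); rewrite cartanE PV hE rank_e raddf_sum (bigD1 i) //= big1.
  by rewrite addr0 raddfMz hE rank_e eqxx intz eq_sym => <-; case: eqP.
by move=> l li; rewrite raddfMz hE rank_e (negPf li) mul0rz.
Qed.

(** With p_j the element of A attached to P_j, u = tau(sum_j p_j) satisfies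
beta(c, u) = sum_j chi_j(c). If w u = 0 then sum_j chi_j(c w) = 0 for all c, and
letting c act on one V_i as an arbitrary matrix shows that w acts as zero. *)
Lemma semisimple_unit_preimage : semisimple_ring A -> unit_or_zero_preimage ttau.
Proof.
move=> ssA; have rad0 := semisimple_rad0 ssA; have C1 := semisimple_cartan1 ssA.
have [p pE] := choice (fun j => projective_character (P j)).
have [irrV uniqV _] := repsV.
have uE c : beta c (tau (\sum_j p j)) = \sum_j character (V j) c.
  rewrite (raddf_sum (higman_trace x y)) (linear_sumr beta); apply: eq_bigr => j _.
  rewrite beta_tau -pE cartan_character C1 (bigD1 j) //= big1 => [|i ij].
    by rewrite addr0 mxE eqxx.
  by rewrite mxE (negPf ij).
have u_unit : tau (\sum_j p j) \is a GRing.unit.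
  apply: injective_unit => w wu0; apply/rad0/(rad_reps repsV) => i.
  apply/matrixP => r s; rewrite [RHS]mxE.
  have [c [ci c0]] := density_mx k_split irrV uniqV (i := i) (delta_mx s r).
  have chi0 j : j != i -> character (V j) (c * w) = 0.
    by move=> ji; rewrite /character rhoM c0 // mul0mx mxtrace0.
  have := uE (c * w); rewrite beta_assoc wu0 linear0r (bigD1 i) //= big1 // addr0.
  rewrite /character rhoM ci => ->; rewrite /mxtrace (bigD1 s) //= big1 => [|t ts].
    rewrite addr0 [RHS]mxE (bigD1 r) //= big1 => [|t tr].
      by rewrite addr0 [delta_mx _ _ _ _]mxE !eqxx mul1r.
    by rewrite mxE (negPf tr) andbF mul0r.
  by rewrite mxE big1 // => q _; rewrite mxE (negPf ts) mul0r.
exists (can_T A (\sum_j p j)); last by left; rewrite -ttauP.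
apply: contraTneq u_unit => z0.
by rewrite [tau _]ttauP z0 linear0 unitr0.
Qed.

Lemma unit_trace_rad0 a : tau a \is a GRing.unit -> forall c, c \in Defs.rad A -> c = 0.
Proof.
move=> u_unit c cR; rewrite -[c](mulrK u_unit).
by rewrite (rad_higman beta_assoc beta_nonsing xy_dual) // mul0r.
Qed.

(** With G_il = lrtrace (e_i) (e_l) and D_lj = chi_l(p_j), where p_j is attached
to P_j, C = G D over k, so G is invertible. As the entries of G (chi_l(a))_l are
the beta(e_i, tau(a)), tau(a) = 0 makes all chi_l(a) vanish. *)
Lemma cartan_det_ttau_inj a : ((\det C)%:~R : k) != 0 -> tau a = 0 -> can_T A a = 0.
Proof.
move=> detC ta0; have [e [ee chi_e _ traceE]] := dual_idempotents k_split repsV.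
have [p pE] := choice (fun j => projective_character (P j)).
have lrE c b : lrtrace c b = \sum_i character (V i) b * lrtrace c (e i).
  apply: (traceE k^o (lrtrace c)); first exact: (lrtrace_linearr beta_assoc xy_dual).
    exact: lrtraceCr.
  by move=> b' b'R; exact: (lrtrace_radr c b'R).
pose G := \matrix_(i, l) lrtrace (e i) (e l).
pose D := \matrix_(l, j) character (V l) (p j).
have CGD : map_mx intr C = G *m D.
  apply/matrixP => i j; rewrite !mxE.
  transitivity (character (val (P j)) (e i)).
    rewrite cartan_character (bigD1 i) //= big1 ?addr0 => [|l li]; first by rewrite chi_e eqxx.
    by rewrite chi_e (negPf li) mul0rz.
  by rewrite pE lrE; apply: eq_bigr => l _; rewrite !mxE mulrC.
have Gunit : G \in unitmx.
  rewrite unitmxE unitfE; apply: contra_neq detC => detG.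
  by rewrite -(det_map_mx (intr : {rmorphism int -> k})) CGD det_mulmx detG mul0r.
pose v := \col_l character (V l) a.
have Gv : G *m v = 0.
  apply/colP => i; rewrite [RHS]mxE; transitivity (lrtrace (e i) a); last first.
    by rewrite -beta_tau ta0 linear0r.
  by rewrite lrE mxE; apply: eq_bigr => l _; rewrite !mxE mulrC.
have v0 : v = 0 by rewrite -[v](mulKmx Gunit) Gv mulmx0.
rewrite (traceE (Tspace (Arad A)) (can_T A)).
- apply: big1 => i _; have := congr1 (fun u : 'cV_n => u i 0) v0.
  by rewrite !mxE => ->; rewrite scale0r.
- by move=> c b d; rewrite /can_T !linearP.
- move=> b d; apply/lproj_eq/mem_gen.
  by exists (lproj (Defs.rad A) b), (lproj (Defs.rad A) d); rewrite -!Arad_mulE.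
by move=> b bR; rewrite /can_T (iffRL (lproj_eq0 _ _) bR) linear0.
Qed.

End CartanMatrix.
End RankFormula.

Theorem theorem3 (k : fieldType) (A : falgType k) (beta : {biscalar A})
    (m : nat) (x y : 'I_m -> A)
    (beta_assoc : associative_form beta)
    (beta_nonsing : nonsingular_form beta)
    (xy_dual : dual_bases x y beta)
    (k_split : splitting_field A) :
  has_rank (tens_map k (cartan A)) (\dim (limg (linfun (higman_trace x y))))
  /\
  forall (n : nat) (V : 'I_n -> fgmod A) (P : 'I_n -> fgproj A) (C : 'M[int]_n)
         (ttau : {linear Tspace (Arad A) -> A}),
    irreducible_reps V -> projective_covers V P -> is_cartan_matrix V P C ->
    induced_trace x y ttau ->
    [<-> semisimple_ring A;
         C = 1%:M /\ unit_or_zero_preimage ttau;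
         ~ char_divides k (\det C) /\ unit_or_zero_preimage ttau].
Proof.
split; first exact: cartan_rank beta_assoc beta_nonsing xy_dual k_split.
move=> n V P C ttau repsV coverP cartanC ttauP; tfae.
- move=> ssA; split; first exact: (semisimple_cartan1 k_split repsV coverP cartanC ssA).
  exact: (semisimple_unit_preimage beta_assoc xy_dual k_split repsV coverP cartanC ttauP ssA).
- move=> [-> ex_unit]; split=> //; rewrite det1 => /intr_eq0_char_divides/eqP.
  by rewrite oner_eq0.
move=> [detC [z zN0 tz]].
have {}detC : (\det C)%:~R != 0 :> k by apply/eqP => /intr_eq0_char_divides.
have [a aE] : exists a, can_T A a = z.
  by exists (lrepr (lrepr z : Arad A)); rewrite /can_T !lreprK.
rewrite -aE -ttauP in tz; apply: rad0_semisimple.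
case: tz => [u_unit|t0]; first exact: (unit_trace_rad0 beta_assoc beta_nonsing xy_dual u_unit).
case/eqP: zN0; rewrite -aE.
exact: (cartan_det_ttau_inj beta_assoc xy_dual k_split repsV cartanC detC t0).
Qed.
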